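(* Let $n\ge1$ and $\beta>0$. For every Lipschitz function $f$ on $\mathbb R^n$ satisfying $\int_{\mathbb R^n}e^{\beta f}dx=1$, \[ \operatorname{Ent}(e^{\beta f}):=\int_{\mathbb R^n}e^{\beta f}\log e^{\beta f}\,dx\le n\log\Big(\frac{\beta k_n}{e}\,\mathcal E_\infty(f)\Big),\qquad k_n=\Big(\frac{1}{n!\,\omega_n}\Big)^{\frac1n}. \] Moreover, equality holds for every function of the form $f(x)=c-b|Ax-a|$ with $a\in\mathbb R^n$, $b>0$, $c\in\mathbb R$, $A\in SL_n$, normalized so that $\int e^{\beta f}dx=1$.
   Context: $\omega_n=\pi^{n/2}/\Gamma(\frac n2+1)$. For $\xi\in\mathbb S^{n-1}$, $\nabla_\xi f=\nabla f\cdot\xi$ and $\|\nabla_\xi f\|_\infty$ is its $L^\infty(\mathbb R^n)$ norm. \[ \mathcal E_\infty(f)=(n\omega_n)^{\frac1n}\Big(\int_{\mathbb S^{n-1}}\|\nabla_\xi f\|_\infty^{-n}\,d\xi\Big)^{-\frac1n}, \] with $d\xi$ the surface measure on $\mathbb S^{n-1}$. $SL_n$ denotes real $n\times n$ matrices with determinant $1$. *)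

(* Defs.v *)
From HB Require Import structures.
From mathcomp Require Import all_boot all_order all_algebra.
From mathcomp Require Import all_classical all_reals all_analysis.
Set Implicit Arguments. Unset Strict Implicit. Unset Printing Implicit Defensive.
Import Order.TTheory GRing.Theory Num.Theory.
Import numFieldNormedType.Exports.
Local Open Scope classical_set_scope.
Local Open Scope ring_scope.

Section Defs.
Variable R : realType.

Definition enorm n (x : 'rV[R]_n) : R := Num.sqrt (\sum_i x 0 i ^+ 2).

(* n-dimensional Lebesgue integral of a nonnegative function, as the
   iterated one-dimensional Lebesgue integral (Tonelli). *)
Fixpoint iint_seq (n : nat) (g : seq R -> \bar R) : \bar R :=
  match n with
  | 0 => g [::]
  | m.+1 => (\int[@lebesgue_measure R]_(t in [set: R]) iint_seq m (fun s => g (t :: s)))%E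
  end.

Definition row_of_seq n (s : seq R) : 'rV[R]_n := \row_i nth 0 s i.

Definition leb_int n (g : 'rV[R]_n -> \bar R) : \bar R :=
  iint_seq n (fun s => g (row_of_seq n s)).

(* measurability for sets of R^n: product sigma-algebra on n-tuples of reals *)
Definition rv_of_tuple n (t : n.-tuple (measurableTypeR R)) : 'rV[R]_n :=
  \row_i tnth t i.

Definition lmeasurable n (A : set 'rV[R]_n) : Prop :=
  measurable (rv_of_tuple (n:=n) @^-1` A).

Definition lnull n (N : set 'rV[R]_n) : Prop :=
  lmeasurable N /\ leb_int (fun x => (\1_N x)%:E) = 0%E.

Definition lae n (P : 'rV[R]_n -> Prop) : Prop :=
  exists N, lnull N /\ [set x | ~ P x] `<=` N.

Definition lebesgue_ess_sup n (h : 'rV[R]_n -> \bar R) : \bar R :=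
  ereal_inf [set y : \bar R | lae (fun x => (h x <= y)%E)].

Definition dir_deriv_Linf n (f : 'rV[R]_n -> R) (xi : 'rV[R]_n) : \bar R :=
  lebesgue_ess_sup (fun x => (`| derive f x xi |)%:E).

(* integral over the unit sphere S^{n-1} with respect to its surface measure,
   via polar coordinates: int_{S^{n-1}} g dxi = n * int_{B_1} g(x/|x|) dx *)
Definition sphere_int n (g : 'rV[R]_n -> \bar R) : \bar R :=
  (n%:R%:E * leb_int (fun x : 'rV[R]_n => if ((enorm x <= 1)%R) && (x != 0%R)
                                then g ((enorm x)^-1 *: x) else 0%E))%E.

Definition Gamma (s : R) : R :=
  fine (\int[@lebesgue_measure R]_(t in `]0%R, +oo[%classic)
          ((t `^ (s - 1)) * expR (- t))%:E)%E.

(* volume of the unit ball *)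
Definition omega n : R := pi `^ (n%:R / 2) / Gamma (n%:R / 2 + 1).

Definition k_const n : R := ((n`!%:R * omega n)^-1) `^ (n%:R^-1).

(* E_infty(f) = (n omega_n)^(1/n) (int_{S^{n-1}} ||nabla_xi f||_infty^(-n) dxi)^(-1/n),
   with the conventions 0^(-n) = +oo, (+oo)^(-1/n) = 0, 0^(-1/n) = +oo. *)
Definition E_inf n (f : 'rV[R]_n -> R) : \bar R :=
  let I := sphere_int (fun xi => match dir_deriv_Linf f xi with
                                 | r%:E => if 0 < r then (r ^- n)%:E else +oo%E
                                 | +oo%E => 0%E
                                 | -oo%E => +oo%E
                                 end) in
  match I with
  | r%:E => if 0 < r then (((n%:R * omega n) / r) `^ (n%:R^-1))%:E else +oo%E
  | +oo%E => 0%E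
  | -oo%E => +oo%E
  end.

(* Ent(e^{beta f}) = int e^{beta f} log e^{beta f} dx, split into positive and
   negative parts (the positive part is always finite here). *)
Definition Ent_exp n (beta : R) (f : 'rV[R]_n -> R) : \bar R :=
  (leb_int (fun x => (expR (beta * f x) * Num.max (beta * f x) 0)%:E)
   - leb_int (fun x => (expR (beta * f x) * Num.max (- (beta * f x)) 0)%:E))%E.

(* right-hand side  n log( beta k_n / e * E_infty(f) ), with log 0 = -oo, log +oo = +oo *)
Definition rhs n (beta : R) (f : 'rV[R]_n -> R) : \bar R :=
  match E_inf f with
  | r%:E => if 0 < r then (n%:R * ln (beta * k_const n / expR 1 * r))%:E else -oo%E
  | +oo%E => +oo%E
  | -oo%E => -oo%E
  end.

Definition lipschitz_Rn n (f : 'rV[R]_n -> R) : Prop :=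
  exists L : R, forall x y, `| f x - f y | <= L * enorm (x - y).

End Defs.

(* Main.v *)
(** Let q(v) be the Lipschitz constant of f in the direction v. By Lebesgue
    differentiation on lines q(v) is the essential supremum of |nabla_v f|, so
    in polar coordinates the integral over the sphere is n |{q <= 1}|. Since
    Z := int e^(-beta q) = n! beta^(-n) |{q <= 1}|, the right-hand side equals
    - n - ln Z.

    For s > 1 one has f(x) - (s - 1) q(y) <= f(x + (s - 1) y), so the
    Prekopa-Leindler inequality with weight 1/s gives
    int e^(s beta f) <= s^(-n) Z^(1 - s), with equality at s = 1. Comparing the
    derivatives at s = 1 gives the entropy bound. For f = c - b |Ax - a|, q is
    b |Av|, and the Gamma integrals of q evaluate both sides. *)

Require Import Defs.
From HB Require Import structures.
From mathcomp Require Import all_boot all_order all_algebra.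
From mathcomp Require Import all_classical all_reals all_analysis.
From mathcomp Require Import measurable_realfun ring lra.
Set Implicit Arguments. Unset Strict Implicit. Unset Printing Implicit Defensive.
Import Order.TTheory GRing.Theory Num.Theory.
Import numFieldNormedType.Exports.
Local Open Scope classical_set_scope.
Local Open Scope ring_scope.

(** * Prekopa-Leindler inequality *)

(** Since the integral on R^n is an iteration of integrals on the line, Prekopa-Leindler is proved
    on the line and then tensorized, and the only changes of variables in R^n are translations and
    homotheties. Surface measure and linear substitutions never appear: the homogeneity of q gives
    |{q <= r}| = r^n |{q <= 1}|, and Tonelli turns this into every radial integral.

    Rademacher's theorem is avoided too. An essential bound on ['D_v f] is used on almost every line
    parallel to v, where one-dimensional differentiation is enough, and continuity carries the
    resulting increment bound to the remaining lines.

    The entropy is not known to be finite beforehand, so its positive and negative parts stay on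
    opposite sides of the inequalities until finiteness is settled. Finiteness of Z itself comes
    from Prekopa-Leindler: Z = +oo would contradict int e^(beta f) = 1. *)

Section Lebesgue1D.
Context {R : realType}.
Local Notation mu := (@lebesgue_measure R).
Local Notation MR := (measurableTypeR R).

Lemma lebesgue_measure_shift (a : R) (A : set R) : measurable A ->
  mu ((fun x => x + a) @^-1` A) = mu A.
Proof.
move=> mA.
have mf : measurable_fun [set: MR] (fun x : MR => (x + a : MR)).
  exact: measurable_funD.
suff H : mu A = pushforward mu (fun x : MR => (x + a : MR)) A by rewrite H.
apply: (@lebesgue_measure_unique R (pushforward mu (fun x : MR => (x + a : MR)))) => //.
move=> _ [[x y]] _ <- /=; rewrite /pushforward.
have -> : (fun x0 : R => x0 + a) @^-1` `]x, y] = `]x - a, y - a]%classic.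
  by apply/seteqP; split => z /=; rewrite !in_itv/= ltrBlDr lerBrDr.
rewrite lebesgue_measure_itv/= [in RHS]lebesgue_measure_itv/= !lte_fin ltrD2r.
by case: ifP => // _; rewrite -!EFinB; congr EFin; ring.
Qed.

Lemma lebesgue_measure_scale (c : R) (A : set R) : 0 < c -> measurable A ->
  mu ((fun x => c * x) @^-1` A) = ((c^-1)%:E * mu A)%E.
Proof.
move=> c0 mA.
have mf : measurable_fun [set: MR] (fun x : MR => (c * x : MR)).
  exact: measurable_funM.
have ci : 0 <= c by apply/ltW.
suff H : mu A = mscale (NngNum ci) (pushforward mu (fun x : MR => (c * x : MR))) A.
  rewrite (H mf) /mscale/= /pushforward muleA -EFinM mulVf ?mul1e//.
  by rewrite gt_eqF.
move=> m; apply: lebesgue_measure_unique => //.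
move=> _ [[x y]] _ <- /=; rewrite /mscale/= /pushforward.
have -> : (fun x0 : R => c * x0) @^-1` `]x, y] = `]c^-1 * x, c^-1 * y]%classic.
  by apply/seteqP; split => z /=; rewrite !in_itv/= ltr_pdivrMl// ler_pdivlMl.
have E (u v : R) : mu `]u, v]%classic = if u < v then (v - u)%:E else 0%E.
  by rewrite lebesgue_measure_itv/= lte_fin.
rewrite E; apply: eq_trans (esym (congr1 (fun z => c%:E * z)%E (E _ _))).
rewrite ltr_pM2l ?invr_gt0//.
case: ifP => // _; last by rewrite mule0.
by rewrite -EFinM; congr EFin; field; rewrite gt_eqF.
Qed.

Lemma ge0_integral_shift (a : R) (F : R -> \bar R) :
  measurable_fun [set: R] F -> (forall x, (0 <= F x)%E) ->
  (\int[mu]_x F (x + a)%R = \int[mu]_x F x)%E.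
Proof.
move=> mF F0.
have mf : measurable_fun [set: MR] (fun x : MR => (x + a : MR)).
  exact: measurable_funD.
transitivity (\int[pushforward mu (fun x : MR => (x + a)%R : MR)]_x F x)%E.
  by rewrite ge0_integral_pushforward.
by apply: eq_measure_integral => A mA _; exact: lebesgue_measure_shift.
Qed.

Lemma ge0_integral_scale (c : R) (F : R -> \bar R) : 0 < c ->
  measurable_fun [set: R] F -> (forall x, (0 <= F x)%E) ->
  (\int[mu]_x F (c * x)%R = (c^-1)%:E * \int[mu]_x F x)%E.
Proof.
move=> c0 mF F0.
have mf : measurable_fun [set: MR] (fun x : MR => (c * x : MR)).
  exact: measurable_funM.
have ci : 0 <= c^-1 by rewrite invr_ge0 ltW.
transitivity (\int[pushforward mu (fun x : MR => (c * x)%R : MR)]_x F x)%E.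
  by rewrite ge0_integral_pushforward.
transitivity (\int[mscale (NngNum ci) mu]_x F x)%E.
  by apply: eq_measure_integral => A mA _; exact: lebesgue_measure_scale.
by rewrite ge0_integral_mscale.
Qed.

End Lebesgue1D.

(** * Brunn-Minkowski inequality on the line *)

Section BrunnMinkowski.
Context {R : realType}.
Local Notation mu := (@lebesgue_measure R).

Lemma lebesgue_measureD1 (A : set R) (x : R) : measurable A ->
  mu (A `\ x) = mu A.
Proof.
move=> mA; have mD : measurable (A `\ x) by exact: measurableD.
apply/eqP; rewrite eq_le; apply/andP; split.
  by apply: le_measure; rewrite ?inE//; move=> y [].
apply: (@le_trans _ _ (mu ((A `\ x) `|` [set x]))).
  apply: le_measure; rewrite ?inE//; first exact: measurableU.
  by move=> y Ay; have [->|/eqP yx] := eqVneq y x; [right|left].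
apply: le_trans (measureU2 _ _ _) _ => //.
by rewrite [X in (_ + X <= _)%E]lebesgue_measure_set1 adde0.
Qed.

(** With m = min B and M = max A, the translates A + m and B + M both lie in A + B and meet at most
    at m + M. Deleting this one point makes them disjoint without changing the measure. *)
Lemma brunn_minkowski_compact (A B C : set R) :
  compact A -> compact B -> measurable C -> A !=set0 -> B !=set0 ->
  (forall x y, A x -> B y -> C (x + y)) -> (mu A + mu B <= mu C)%E.
Proof.
move=> cA cB mC A0 B0 ABC.
have mA : measurable A by exact: compact_measurable.
have mB : measurable B by exact: compact_measurable.
have cid (D : set R) : {within D, continuous (@idfun R)}.
  by apply: continuous_subspaceT => x.
have [M /set_mem AM Mmax] := compact_EVT_max A0 cA (cid A).
have [m /set_mem Bm mmin] := compact_EVT_min B0 cB (cid B).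
have mS (D : set R) a : measurable D -> measurable ((fun x : R => x + a) @^-1` D).
  move=> mD; rewrite -[X in measurable X]setTI.
  have mf : measurable_fun [set: R] (fun x : R => x + a) by exact: measurable_funD.
  exact: mf.
pose A' := (fun x : R => x + (- m)) @^-1` A.
pose B' := (fun x : R => x + (- M)) @^-1` B.
have mA' : measurable A' by exact: mS.
have mB' : measurable B' by exact: mS.
rewrite -(lebesgue_measure_shift (- m) mA) -(lebesgue_measure_shift (- M) mB).
rewrite -/A' -/B' -(@lebesgue_measureD1 A' (m + M))//.
rewrite -measureU//; last 2 first.
- exact: measurableD.
- apply/seteqP; split => // x [[/= Ax xmM] Bx].
  have := Mmax (x - m); rewrite inE => /(_ Ax) /= h1.
  have := mmin (x - M); rewrite inE => /(_ Bx) /= h2.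
  by apply: xmM; lra.
apply: le_measure; rewrite ?inE//.
  by apply: measurableU => //; exact: measurableD.
move=> x [[/= Ax _]|/= Bx].
  by have := ABC _ _ Ax Bm; rewrite subrK.
by have := ABC _ _ AM Bx; rewrite addrC subrK.
Qed.

(** Inner regularity reduces to compact subsets. The two suprema are taken one after the other, each
    time subtracting a measure first shown to be finite. *)
Lemma brunn_minkowski (A B C : set R) :
  measurable A -> measurable B -> measurable C -> A !=set0 -> B !=set0 ->
  (forall x y, A x -> B y -> C (x + y)) -> (mu A + mu B <= mu C)%E.
Proof.
move=> mA mB mC [a Aa] [b Bb] ABC.
have [->|] := eqVneq (mu C) +oo%E; first by rewrite leey.
rewrite -ltey => Coo.
have Cfin : mu C \is a fin_num by rewrite ge0_fin_numE.
(* The compact sets offered by inner regularity may be empty; adjoining a point of A or of B makes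
   the compact case applicable. *)
have c1 (D : set R) x : compact D -> compact (D `|` [set x]).
  by move=> cD; apply: compactU => //; exact: compact_set1.
have key K L : compact K -> compact L -> K `<=` A -> L `<=` B ->
    (mu K + mu L <= mu C)%E.
  move=> cK cL KA LB.
  apply: (@le_trans _ _ (mu (K `|` [set a]) + mu (L `|` [set b]))%E).
    by apply: leeD; apply: le_measure; rewrite ?inE//;
      try (by move=> ?; left); apply: compact_measurable => //; exact: c1.
  apply: brunn_minkowski_compact => //; try exact: c1.
  - by exists a; right.
  - by exists b; right.
  - move=> x y Kx Ly; apply: ABC.
      by case: Kx => [/KA//|->].
    by case: Ly => [/LB//|->].
have h2 K : compact K -> K `<=` A -> (mu K + mu B <= mu C)%E.
  move=> cK KA; have mK := compact_measurable cK.
  have Kfin : mu K \is a fin_num.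
    rewrite ge0_fin_numE//; apply: le_lt_trans Coo.
    apply: le_trans (key _ set0 cK (@compact0 _) KA _) => //.
    by rewrite measure0 adde0.
  rewrite addeC -leeBrDr//.
  rewrite [X in (X <= _)%E](lebesgue_regularity_inner_sup mB).
  apply: ge_ereal_sup => _ [L [cL LB] <-].
  by rewrite leeBrDr// addeC key.
have Bfin : mu B \is a fin_num.
  rewrite ge0_fin_numE//; apply: le_lt_trans Coo.
  apply: le_trans (h2 set0 (@compact0 _) _) => //.
  by rewrite measure0 add0e.
rewrite -leeBrDr//.
rewrite [X in (X <= _)%E](lebesgue_regularity_inner_sup mA).
apply: ge_ereal_sup => _ [L [cL LB] <-].
by rewrite leeBrDr// h2.
Qed.

End BrunnMinkowski.

(** This encodes U^s W^(1 - s) <= H through the reals strictly below U and W. It needs no powers or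
    products of infinite values, and it holds vacuously when U or W is 0. *)
Definition pl_rel {R : realType} (s : R) (U W H : \bar R) : Prop :=
  forall a b : R, 0 < a -> 0 < b -> (a%:E < U)%E -> (b%:E < W)%E ->
    ((a `^ s * b `^ (1 - s))%:E <= H)%E.

(** Apply ln x <= x - 1 to a / m and b / m, where m is the weighted arithmetic mean: the weighted
    sum of the right-hand sides is 0. *)
Lemma powR_amgm {R : realType} (s a b : R) : 0 < s < 1 -> 0 < a -> 0 < b ->
  a `^ s * b `^ (1 - s) <= s * a + (1 - s) * b.
Proof.
move=> /andP[s0 s1] a0 b0; set m := (X in _ <= X).
have m0 : 0 < m by rewrite addr_gt0 ?mulr_gt0 ?subr_gt0.
have lnle (x : R) : 0 < x -> ln x <= x - 1.
  by move=> x0; have := expR_ge1Dx (ln x); rewrite lnK ?posrE//; lra.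
have ha := lnle _ (divr_gt0 a0 m0); have hb := lnle _ (divr_gt0 b0 m0).
rewrite !ln_div ?posrE// in ha hb.
rewrite -[leRHS]lnK ?posrE// /powR !gt_eqF// -expRD ler_expR.
have E : s * (a / m) + (1 - s) * (b / m) = 1.
  by rewrite -(@divff _ m) ?gt_eqF// /m; field; rewrite -/m gt_eqF.
have h1 : s * (ln a - ln m) <= s * (a / m - 1) by rewrite ler_pM2l.
have h2 : (1 - s) * (ln b - ln m) <= (1 - s) * (b / m - 1).
  by rewrite ler_pM2l// subr_gt0.
lra.
Qed.

Lemma measurable_set_bool d (T : measurableType d) (p : T -> bool) :
  measurable_fun [set: T] p -> measurable [set x | p x].
Proof.
by move=> mp; have := mp measurableT [set true] I; rewrite setTI.
Qed.

(** * Prekopa-Leindler on the line, by level sets *)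

Section PrekopaLeindler1.
Context {R : realType}.
Local Notation mu := (@lebesgue_measure R).
Local Open Scope ereal_scope.

Lemma lebesgue_measure_itv0 (v : \bar R) : 0 <= v ->
  mu [set r | (0 < r)%R && (r%:E < v)] = v.
Proof.
case: v => [v| |]// v0.
- have -> : [set r : R | (0 < r)%R && (r%:E < v%:E)] = `]0%R, v[%classic.
    by apply/seteqP; split => r /=; rewrite in_itv/= lte_fin.
  rewrite lebesgue_measure_itv/= lte_fin; case: ifPn => [_|]; first by rewrite oppr0 adde0.
  by rewrite -leNgt => v1; congr EFin; apply/eqP; rewrite eq_le v1 andbT -lee_fin.
- have -> : [set r : R | (0 < r)%R && (r%:E < +oo)] = `]0%R, +oo[%classic.
    by apply/seteqP; split => r /=; rewrite in_itv/= ltry.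
  by rewrite lebesgue_measure_itv/= ltry.
Qed.

Lemma measurable_level d (T : measurableType d) (f : T -> \bar R) :
  measurable_fun [set: T] f ->
  measurable [set p : T * R | (0 < p.2)%R && (p.2%:E < f p.1)].
Proof.
move=> mf; apply: measurable_set_bool; apply: measurable_and.
  by apply: measurable_fun_ltr => //; exact: measurable_cst.
apply: measurable_fun_lte; first exact/measurable_EFinP.
exact: measurableT_comp.
Qed.

Lemma layer_cake d (T : measurableType d) (m : {sigma_finite_measure set T -> \bar R})
    (f : T -> \bar R) : measurable_fun [set: T] f -> (forall x, 0 <= f x) ->
  \int[m]_x f x = \int[mu]_r m [set x | (0 < r)%R && (r%:E < f x)].
Proof.
move=> mf f0; have mA := measurable_level mf.
have := @indic_fubini_tonelli _ _ _ _ _ m mu _ mA.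
rewrite indic_fubini_tonelli_FE// indic_fubini_tonelli_GE// => E.
transitivity (\int[m]_x (mu \o xsection [set p | (0 < p.2)%R && ((p.2)%:E < f p.1)]) x).
  apply: eq_integral => x _; rewrite /= xsectionE.
  by rewrite -[LHS]lebesgue_measure_itv0.
by rewrite E; apply: eq_integral => r _; rewrite /= ysectionE.
Qed.

Lemma measurable_layer d (T : measurableType d) (m : {sigma_finite_measure set T -> \bar R})
    (f : T -> \bar R) : measurable_fun [set: T] f ->
  measurable_fun [set: R] (fun r : R => m [set x | (0 < r)%R && (r%:E < f x)]).
Proof.
move=> mf; have := measurable_fun_ysection m (measurable_level mf).
by apply: eq_measurable_fun => r _; rewrite /= ysectionE.
Qed.

(** Writing levels as C r lets three functions, each normalized by its own constant, share the level
    parameter r. *)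
Lemma layer_cake_scale (C : R) (f : R -> \bar R) : (0 < C)%R ->
  measurable_fun [set: R] f -> (forall x, 0 <= f x) ->
  \int[mu]_x f x =
    C%:E * \int[mu]_r mu [set x | (0 < C * r)%R && ((C * r)%:E < f x)].
Proof.
move=> C0 mf f0; rewrite layer_cake//.
rewrite (@ge0_integral_scale _ C (fun r => mu [set x | (0 < r)%R && (r%:E < f x)]))//.
  by rewrite muleA -EFinM divff ?gt_eqF// mul1e.
exact: measurable_layer.
Qed.

Import HBNNSimple.

(** The one-dimensional argument normalizes functions by their suprema, so u is replaced by a simple
    function below it. This also covers a nonmeasurable u, whose integral is a supremum over such
    functions. *)
Lemma lt_integral_bounded (u : R -> \bar R) (a : R) : (forall x, 0 <= u x) ->
  a%:E < \int[mu]_x u x -> (0 < a)%R ->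
  exists f : R -> R, exists A : R, [/\ measurable_fun [set: R] f,
    (forall x, (0 <= f x)%R), (forall x, (f x)%:E <= u x),
    a%:E < \int[mu]_x (f x)%:E &
    [/\ (0 < A)%R, (forall x, (f x <= A)%R) & (forall r, (r < A)%R -> exists x, (r < f x)%R)]].
Proof.
move=> u0; rewrite ge0_integralTE// => /ereal_sup_gt[_ [/= f fu <-]].
rewrite -integralT_nnsfun => af a0.
have [M [Mr bM]] := simple_bounded f.
have bf x : (f x <= M + 1)%R.
  by apply: le_trans (ler_norm _) _; apply: bM => //; rewrite ltrDl.
have hs : has_sup (range f).
  by split; [exists (f point), point|exists (M + 1)%R => _ [x _ <-]].
exists f, (sup (range f)).
have fA x : (f x <= sup (range f))%R.
  by apply: ub_le_sup; [case: hs|exists x].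
split; [exact: (@measurable_funPT _ _ _ _ f) | by [] | by [] | by [] | split => //].
- rewrite ltNge; apply/negP => A0.
  have : \int[mu]_x (f x)%:E <= \int[mu]_x (0 : \bar R).
    apply: ge0_le_integral => //.
    - by move=> x _; rewrite lee_fin.
    - exact/measurable_EFinP.
    - by move=> x _; rewrite lee_fin (le_trans (fA x)).
  rewrite integral0 => /(lt_le_trans af); rewrite lte_fin; lra.
- move=> r rA; have [_ [x _ <-]] := sup_gt (hs.1) rA.
  by exists x.
Qed.

(** Let f, g be bounded minorants with suprema A, B, and C = A^s B^(1 - s). For 0 < r < 1 the sets
    {f > A r} and {g > B r} are nonempty, and their combination with weights s, 1 - s lies in {h > C
    r}. Brunn-Minkowski integrated over r gives int h >= C (s int f / A + (1 - s) int g / B), and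
    the arithmetic-geometric inequality finishes. *)
Lemma prekopa_leindler1 (s : R) (u w h : R -> \bar R) : (0 < s < 1)%R ->
  measurable_fun [set: R] h ->
  (forall x, 0 <= u x) -> (forall x, 0 <= w x) -> (forall x, 0 <= h x) ->
  (forall x y, pl_rel s (u x) (w y) (h (s * x + (1 - s) * y)%R)) ->
  pl_rel s (\int[mu]_x u x) (\int[mu]_x w x) (\int[mu]_x h x).
Proof.
move=> s01 mh u0 w0 h0 uwh a b a0 b0 aU bW; have /andP[s0 s1] := s01.
have s1' : (0 < 1 - s)%R by rewrite subr_gt0.
have [f [A [mf f0 fu af [A0 fA Af]]]] := lt_integral_bounded u0 aU a0.
have [g [B [mg g0 gw bg [B0 gB Bg]]]] := lt_integral_bounded w0 bW b0.
pose C := (A `^ s * B `^ (1 - s))%R.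
have C0 : (0 < C)%R by rewrite mulr_gt0// powR_gt0.
have mE (k : R -> R) : measurable_fun [set: R] k ->
  measurable_fun [set: R] (EFin \o k) by move=> ?; exact/measurable_EFinP.
pose F (k : R -> \bar R) (D r : R) : \bar R :=
  mu [set x | (0 < D * r)%R && ((D * r)%:E < k x)].
have mF k D : measurable_fun [set: R] k -> measurable_fun [set: R] (F k D).
  move=> mk; have := measurable_layer mu mk.
  move=> /measurableT_comp; apply; exact: measurable_funM.
have mFf c : measurable_fun [set: R] (fun r => c%:E * F (EFin \o f) A r).
  by apply: measurable_funeM; apply: mF; exact: mE.
have mFg c : measurable_fun [set: R] (fun r => c%:E * F (EFin \o g) B r).
  by apply: measurable_funeM; apply: mF; exact: mE.
have F0 k D r : 0 <= F k D r by exact: measure_ge0.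
have mset k D r : measurable_fun [set: R] k ->
    measurable [set x | (0 < D * r)%R && ((D * r)%:E < k x)].
  move=> mk; apply: measurable_set_bool; apply: measurable_and => //.
  by apply: measurable_fun_lte => //; exact: measurable_cst.
have key r : s%:E * F (EFin \o f) A r + (1 - s)%:E * F (EFin \o g) B r <= F h C r.
  have [r0|r0] := leP r 0%R.
    rewrite /F.
    suff E k D : (0 < D)%R -> [set x : R | (0 < D * r)%R && ((D * r)%:E < k x)] = set0.
      by rewrite !E// measure0 !mule0 adde0.
    move=> D0; apply/seteqP; split => // x /= /andP[+ _].
    by rewrite pmulr_rgt0// ltNge r0.
  (* From level 1 on both sets are empty, because A and B are upper bounds; below it they are
     nonempty, because A and B are suprema. *)
  have [r1|r1] := leP 1%R r.
    rewrite /F.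
    suff E (k : R -> R) D : (0 < D)%R -> (forall x, (k x <= D)%R) ->
        [set x : R | (0 < D * r)%R && ((D * r)%:E < (EFin \o k) x)] = set0.
      by rewrite !E// measure0 !mule0 adde0.
    move=> D0 kD; apply/seteqP; split => // x /= /andP[_]; rewrite lte_fin => h1.
    have := kD x; have : (D <= D * r)%R by rewrite ler_peMr// ltW.
    lra.
  have E (k : R -> \bar R) D c : (0 < c)%R -> measurable_fun [set: R] k ->
      c%:E * F k D r = mu ((fun x => c^-1 * x)%R @^-1`
         [set x | (0 < D * r)%R && ((D * r)%:E < k x)]).
    move=> c0 mk; rewrite lebesgue_measure_scale ?invr_gt0 ?invrK//.
    exact: mset.
  have mpre (c : R) S : measurable S -> measurable ((fun x => c^-1 * x)%R @^-1` S).
    move=> mS; rewrite -[X in measurable X]setTI.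
    have : measurable_fun [set: R] (fun x : R => c^-1 * x)%R by exact: measurable_funM.
    exact.
  rewrite !E//; try exact: mE.
  apply: brunn_minkowski => //; try (by apply: mpre; apply: mset; exact: mE).
  - exact: mset.
  - have [|x hx] := Af (A * r)%R; first by rewrite gtr_pMr.
    by exists (s * x)%R => /=; rewrite mulKf ?gt_eqF// lte_fin hx mulr_gt0.
  - have [|x hx] := Bg (B * r)%R; first by rewrite gtr_pMr.
    by exists ((1 - s) * x)%R => /=; rewrite mulKf ?gt_eqF// lte_fin hx mulr_gt0.
  - move=> x y /= /andP[Ar0 fx] /andP[Br0 gy]; rewrite mulr_gt0//=.
    rewrite !lte_fin in fx gy.
    (* [pl_rel] only speaks of values strictly below u and w. The midpoints a' and b' are such
       values and still exceed A r and B r, which gives the strict bound C r < h. *)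
    have /midf_lt[lx ux] := fx; have /midf_lt[ly uy] := gy.
    set a' := (X in (X < f _)%R) in ux; set b' := (X in (X < g _)%R) in uy.
    have a'0 : (0 < a')%R by exact: lt_trans lx.
    have b'0 : (0 < b')%R by exact: lt_trans ly.
    have := uwh (s^-1 * x)%R ((1 - s)^-1 * y)%R a' b' a'0 b'0.
    rewrite mulVKf ?gt_eqF// mulVKf ?gt_eqF//.
    move=> /(_ (lt_le_trans _ (fu _))); rewrite lte_fin => /(_ ux).
    move=> /(_ (lt_le_trans _ (gw _))); rewrite lte_fin => /(_ uy).
    apply: lt_le_trans; rewrite lte_fin.
    have -> : (C * r = (A * r) `^ s * (B * r) `^ (1 - s))%R.
      rewrite !powRM ?ltW//; rewrite mulrACA -powRD ?[(s + _)%R]addrC ?subrK ?powRr1 ?ltW//.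
      by rewrite oner_eq0.
    by apply: ltr_pM; rewrite ?powR_ge0//; apply: gt0_ltr_powR => //;
      rewrite nnegrE ltW.
have hint : C%:E * (s%:E * \int[mu]_r F (EFin \o f) A r +
    (1 - s)%:E * \int[mu]_r F (EFin \o g) B r) <= \int[mu]_x h x.
  rewrite (layer_cake_scale C0 mh)//; apply: lee_pmul => //.
  - by rewrite lee_fin ltW.
  - by rewrite adde_ge0// mule_ge0 ?integral_ge0// lee_fin ltW.
  rewrite -!ge0_integralZl//; try (by rewrite lee_fin ltW); try (by apply: mF; exact: mE).
  rewrite -ge0_integralD//; first last.
  - exact: mFg.
  - by move=> r _; rewrite mule_ge0// lee_fin ltW.
  - exact: mFf.
  - by move=> r _; rewrite mule_ge0// lee_fin ltW.
  apply: ge0_le_integral => //.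
  - by move=> r _; rewrite adde_ge0// mule_ge0// lee_fin ltW.
  - by apply: emeasurable_funD; [exact: mFf|exact: mFg].
  - exact: mF.
apply: le_trans hint.
have low (k : R -> R) D c : measurable_fun [set: R] k -> (forall x, (0 <= k x)%R) ->
    (0 < D)%R -> c%:E < \int[mu]_x (k x)%:E ->
    (D^-1 * c)%:E <= \int[mu]_r F (EFin \o k) D r.
  move=> mk k0 D0; rewrite (layer_cake_scale D0); last 2 first.
  - exact: mE.
  - by move=> x; rewrite lee_fin.
  by move=> /ltW; rewrite EFinM lee_pdivrMl.
apply: (@le_trans _ _ (C * (s * (A^-1 * a) + (1 - s) * (B^-1 * b)))%R%:E).
  rewrite lee_fin.
  (* The normalized values a / A and b / B are compared; the factor C turns their geometric mean
     back into a^s b^(1 - s). *)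
  have := powR_amgm s01 (_ : 0 < A^-1 * a)%R (_ : 0 < B^-1 * b)%R.
  rewrite !mulr_gt0 ?invr_gt0// => /(_ isT isT) h1.
  apply: le_trans (ler_wpM2l (ltW C0) h1).
  have E (x y p : R) : (0 < x)%R -> (0 < y)%R -> (y `^ p = x `^ p * (x^-1 * y) `^ p)%R.
    by move=> x0 y0; rewrite -powRM ?mulr_ge0 ?invr_ge0 ?ltW// mulVKf// gt_eqF.
  by rewrite (E A a s)// (E B b (1 - s)%R)// mulrACA.
rewrite EFinM EFinD !(EFinM _ (_ * _)%R); apply: lee_pmul => //.
- by rewrite lee_fin ltW.
- by rewrite -!EFinM -EFinD lee_fin addr_ge0// ltW// !mulr_gt0 ?invr_gt0.
by apply: leeD; rewrite lee_pmul2l// ?lte_fin//; exact: low.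
Qed.

End PrekopaLeindler1.

(** * The iterated integral as integration against a sigma-finite measure *)

Section SigmaFinitePack.
Context d (T : measurableType d) (R : realType) (m : {measure set T -> \bar R}).
Hypothesis sf : sigma_finite [set: T] m.

(** A copy of m to which the section's sigma-finiteness hypothesis can be attached as an
    instance. *)
Definition sigma_finite_pack : set T -> \bar R := m.

HB.instance Definition _ := Measure.on sigma_finite_pack.
HB.instance Definition _ :=
  @Measure_isSigmaFinite.Build _ _ _ sigma_finite_pack sf.

Lemma sigma_finite_measure_ex :
  exists m' : {sigma_finite_measure set T -> \bar R}, forall A, m' A = m A.
Proof. by exists sigma_finite_pack. Qed.

End SigmaFinitePack.

Lemma sigma_finite_product d1 d2 (T1 : measurableType d1) (T2 : measurableType d2)
    (R : realType) (m1 : {sigma_finite_measure set T1 -> \bar R})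
    (m2 : {sigma_finite_measure set T2 -> \bar R}) :
  sigma_finite [set: T1 * T2] (m1 \x m2)%E.
Proof.
have /sigma_finiteP[F [TF ndF Foo]] := sigma_finiteT m1.
have /sigma_finiteP[G [TG ndG Goo]] := sigma_finiteT m2.
exists (fun n => F n `*` G n).
  rewrite -setXTT TF TG; apply/seteqP; split => -[x y] /=.
    move=> [[i _ Fx] [j _ Gy]]; exists (maxn i j) => //; split.
      by move: x Fx; exact/subsetPset/ndF/leq_maxl.
    by move: y Gy; exact/subsetPset/ndG/leq_maxr.
  by move=> [i _ [/= Fx Gy]]; split; exists i.
move=> k; have [mF Fk] := Foo k; have [mG Gk] := Goo k; split.
  exact: measurableX.
by rewrite product_measure1E// lte_mul_pinfty// ge0_fin_numE.
Qed.

(** The left inverse g carries an exhaustion of the product over to T: the preimage under f of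
    g^-1(F i) is F i, so finiteness of the measures is kept. *)
Lemma sigma_finite_pushforward_prod d1 d2 d (T1 : measurableType d1)
    (T2 : measurableType d2) (T : measurableType d) (R : realType)
    (m1 : {sigma_finite_measure set T1 -> \bar R})
    (m2 : {sigma_finite_measure set T2 -> \bar R})
    (f : T1 * T2 -> T) (g : T -> T1 * T2) : measurable_fun [set: T1 * T2] f ->
  measurable_fun [set: T] g -> cancel f g ->
  exists m : {sigma_finite_measure set T -> \bar R},
    forall A, m A = pushforward (m1 \x m2)%E f A.
Proof.
move=> mf mg fK.
have sf : sigma_finite [set: T] (pushforward (m1 \x m2)%E f).
  have [F FT Ffin] := sigma_finite_product m1 m2.
  exists (fun i => g @^-1` (F i)).
    by rewrite -preimage_bigcup -FT preimage_setT.
  move=> i; have [mFi Fi] := Ffin i; split.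
    by rewrite -[X in measurable X]setTI; exact: mg.
  rewrite /pushforward -comp_preimage.
  by rewrite (_ : g \o f = id) ?preimage_id//; apply/funext.
by apply: (sigma_finite_measure_ex sf).
Qed.

Section LebesgueN.
Context {R : realType}.
Local Notation mu := (@lebesgue_measure R).
Local Notation MR := (measurableTypeR R).

Lemma eq_iint_seq n (g h : seq R -> \bar R) :
  (forall s, size s = n -> g s = h s) -> iint_seq n g = iint_seq n h.
Proof.
elim: n g h => [|n IH] g h gh /=; first exact: gh.
by apply: eq_integral => t _; apply: IH => s sn; apply: gh; rewrite /= sn.
Qed.

Lemma iint_seq_ge0 n (g : seq R -> \bar R) :
  (forall s, 0 <= g s)%E -> (0 <= iint_seq n g)%E.
Proof.
elim: n g => [|n IH] g g0 //=.
by apply: integral_ge0 => t _; exact: IH.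
Qed.

Definition seq_measurable n (g : seq R -> \bar R) :=
  measurable_fun [set: n.-tuple MR] (fun t : n.-tuple MR => g t).

Let tcons n (p : MR * n.-tuple MR) : n.+1.-tuple MR := [the n.+1.-tuple MR of p.1 :: p.2].
Let tuncons n (t : n.+1.-tuple MR) : MR * n.-tuple MR := (thead t, [tuple of behead t]).

Let measurable_tcons n : measurable_fun [set: MR * n.-tuple MR] (@tcons n).
Proof. exact: measurable_cons. Qed.

Let measurable_tuncons n : measurable_fun [set: n.+1.-tuple MR] (@tuncons n).
Proof.
apply/measurable_fun_pairP; split; first exact: measurable_tnth.
exact: measurable_behead.
Qed.

Let tconsK n : cancel (@tcons n) (@tuncons n).
Proof. by move=> [x t]; congr (_, _); apply: val_inj. Qed.

(** The measure is built by induction, as the image under consing of the product of [mu] with the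
    n-dimensional measure, starting from the Dirac mass at the empty tuple. It makes the Tonelli
    theorems available for [iint_seq]. *)
Lemma lebesgue_n_ex n : exists m : {sigma_finite_measure set (n.-tuple MR) -> \bar R},
  forall g : seq R -> \bar R, (forall s, 0 <= g s)%E -> seq_measurable n g ->
    iint_seq n g = (\int[m]_t g t)%E.
Proof.
elim: n => [|n [m IH]].
  have sf : sigma_finite [set: 0.-tuple MR] (@dirac _ (0.-tuple MR) [tuple] R).
    by apply: fin_num_fun_sigma_finite; [rewrite measure0|exact: fin_num_measure].
  have [m mE] := sigma_finite_measure_ex sf.
  exists m => g g0 mg /=.
  rewrite (@eq_measure_integral _ _ _ _ (@dirac _ (0.-tuple MR) [tuple] R)).
    by rewrite integral_dirac// diracT mul1e.
  by move=> A mA _; exact: mE.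
have [m' m'E] := sigma_finite_pushforward_prod mu m
  (@measurable_tcons n) (@measurable_tuncons n) (@tconsK n).
exists m' => g g0 mg /=.
have mgc : measurable_fun [set: MR * n.-tuple MR] (fun p => g (tcons p)).
  exact: (measurableT_comp mg (@measurable_tcons n)).
have mt := @measurable_tcons n.
transitivity (\int[pushforward (product_measure1 mu m) (@tcons n)]_t g t)%E.
  rewrite ge0_integral_pushforward//.
  rewrite preimage_setT (fubini_tonelli1 (fun p => g (tcons p)))//.
  apply: eq_integral => t _; rewrite IH//.
  exact: (measurableT_comp mgc (pair1_measurable t)).
by apply: eq_measure_integral => A mA _; exact: (esym (m'E A)).
Qed.

Definition lebesgue_n n := sval (cid (lebesgue_n_ex n)).

Lemma iint_seqE n (g : seq R -> \bar R) : (forall s, 0 <= g s)%E ->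
  seq_measurable n g -> iint_seq n g = (\int[lebesgue_n n]_t g t)%E.
Proof. by rewrite /lebesgue_n; case: cid => m /= H; exact: H. Qed.

Lemma seq_measurable_cons n g t : seq_measurable n.+1 g ->
  seq_measurable n (fun s => g (t :: s)).
Proof.
move=> mg; apply: (measurableT_comp mg) => /=.
by apply: measurable_cons.
Qed.

Lemma measurable_iint_seq_cons n g : (forall s, 0 <= g s)%E -> seq_measurable n.+1 g ->
  measurable_fun [set: R] (fun t => iint_seq n (fun s => g (t :: s))).
Proof.
move=> g0 mg.
have mgc : measurable_fun [set: MR * n.-tuple MR] (fun p => g (tcons p)).
  exact: (measurableT_comp mg (@measurable_tcons n)).
have := @measurable_fun_fubini_tonelli_F _ _ _ _ _ (lebesgue_n n) _ mgc (fun x => g0 _).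
apply: eq_measurable_fun => t _; rewrite iint_seqE//.
exact: seq_measurable_cons.
Qed.

Let combo (c : R) (s a : seq R) := [seq c * p.1 + p.2 | p <- zip s a].

Lemma iint_seq_affine n (c : R) (a : seq R) (g : seq R -> \bar R) : 0 < c ->
  size a = n -> (forall s, 0 <= g s)%E -> seq_measurable n g ->
  (iint_seq n (fun s => g (combo c s a)) = (c ^- n)%:E * iint_seq n g)%E.
Proof.
move=> c0; elim: n a g => [|n IH] [|a0 a]//= g.
  by move=> _ _ _; rewrite expr0 invr1 mul1e.
move=> [sa] g0 mg.
transitivity (\int[mu]_t ((c ^- n)%:E * iint_seq n (fun s => g ((c * t + a0)%R :: s))))%E.
  apply: eq_integral => t _; rewrite -(IH a)//.
  exact: seq_measurable_cons.
have mG := measurable_iint_seq_cons g0 mg.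
have G0 t : (0 <= iint_seq n (fun s => g (t :: s)))%E by exact: iint_seq_ge0.
have cn : (0 <= (c ^- n)%:E :> \bar R)%E by rewrite lee_fin invr_ge0 exprn_ge0// ltW.
rewrite ge0_integralZl//; last first.
  by apply: (measurableT_comp mG); apply: measurable_funD => //; exact: measurable_funM.
rewrite (@ge0_integral_scale _ c (fun t => iint_seq n (fun s => g ((t + a0)%R :: s))))//.
  rewrite (@ge0_integral_shift _ a0 (fun t => iint_seq n (fun s => g (t :: s))))//.
  by rewrite muleA -EFinM exprSr invfM mulrC.
by apply: (measurableT_comp mG); exact: measurable_funD.
Qed.

Let mix (s : R) (x y : seq R) := [seq s * p.1 + (1 - s) * p.2 | p <- zip x y].

(** Tensorization: for fixed first coordinates the induction hypothesis relates the inner integrals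
    by [pl_rel], which is exactly what the one-dimensional inequality asks of its integrands. *)
Lemma prekopa_leindler_seq n (s : R) (u w h : seq R -> \bar R) : 0 < s < 1 ->
  (forall x, 0 <= u x)%E -> (forall x, 0 <= w x)%E -> (forall x, 0 <= h x)%E ->
  seq_measurable n h ->
  (forall x y, size x = n -> size y = n -> pl_rel s (u x) (w y) (h (mix s x y))) ->
  pl_rel s (iint_seq n u) (iint_seq n w) (iint_seq n h).
Proof.
move=> s01; elim: n u w h => [|n IH] u w h u0 w0 h0 mh H /=; first exact: (H [::] [::]).
apply: prekopa_leindler1 => //.
- exact: measurable_iint_seq_cons.
- by move=> x; exact: iint_seq_ge0.
- by move=> x; exact: iint_seq_ge0.
- by move=> x; exact: iint_seq_ge0.
move=> x y; apply: IH => //; first exact: seq_measurable_cons.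
by move=> x' y' sx sy; apply: (H (x :: x') (y :: y')) => /=; rewrite ?sx ?sy.
Qed.

Definition rv_measurable n (g : 'rV[R]_n -> \bar R) :=
  measurable_fun [set: n.-tuple MR] (g \o @rv_of_tuple R n).

Lemma row_of_tuple n (t : n.-tuple MR) : row_of_seq n t = rv_of_tuple t.
Proof. by apply/rowP => i; rewrite !mxE (tnth_nth 0). Qed.

Lemma rv_seq_measurable n (g : 'rV[R]_n -> \bar R) : rv_measurable g ->
  seq_measurable n (fun s => g (row_of_seq n s)).
Proof. by apply: eq_measurable_fun => t _; rewrite row_of_tuple. Qed.

Lemma leb_intE n (g : 'rV[R]_n -> \bar R) : (forall x, 0 <= g x)%E ->
  rv_measurable g -> leb_int g = (\int[lebesgue_n n]_t g (rv_of_tuple t))%E.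
Proof.
move=> g0 mg; rewrite /leb_int iint_seqE//; last exact: rv_seq_measurable.
by apply: eq_integral => t _; rewrite row_of_tuple.
Qed.

Lemma leb_int_affine n (c : R) (a : 'rV[R]_n) (g : 'rV[R]_n -> \bar R) : 0 < c ->
  (forall x, 0 <= g x)%E -> rv_measurable g ->
  (leb_int (fun x => g (c *: x + a)%R) = (c ^- n)%:E * leb_int g)%E.
Proof.
move=> c0 g0 mg; rewrite /leb_int.
rewrite -(@iint_seq_affine n c [seq a 0 i | i <- enum 'I_n])//; last 2 first.
- by rewrite size_map size_enum_ord.
- exact: rv_seq_measurable.
apply: eq_iint_seq => s sn; congr g; apply/rowP => i; rewrite !mxE.
have sa : size [seq a 0 i | i <- enum 'I_n] = n by rewrite size_map size_enum_ord.
rewrite (nth_map (0, 0)) ?size_zip ?sn ?sa ?minnn// nth_zip ?sn ?sa//=.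
by rewrite (nth_map i) ?size_enum_ord// nth_ord_enum.
Qed.

Lemma prekopa_leindler n (s : R) (u w h : 'rV[R]_n -> \bar R) : 0 < s < 1 ->
  (forall x, 0 <= u x)%E -> (forall x, 0 <= w x)%E -> (forall x, 0 <= h x)%E ->
  rv_measurable h ->
  (forall x y, pl_rel s (u x) (w y) (h (s *: x + (1 - s) *: y))) ->
  pl_rel s (leb_int u) (leb_int w) (leb_int h).
Proof.
move=> s01 u0 w0 h0 mh H; rewrite /leb_int.
apply: prekopa_leindler_seq => //; first exact: rv_seq_measurable.
move=> x y sx sy; have := H (row_of_seq n x) (row_of_seq n y).
congr pl_rel; congr h; apply/rowP => i; rewrite !mxE.
by rewrite (nth_map (0, 0)) ?size_zip ?sx ?sy ?minnn// nth_zip ?sx ?sy.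
Qed.

End LebesgueN.

(** * Lipschitz functions of one variable *)

Lemma lebesgue_stieltjes_measure_itv {R : realType} (f : cumulative R R) (a b : R) :
  a <= b -> lebesgue_stieltjes_measure f `]a, b]%classic = (f b - f a)%:E.
Proof.
move=> ab; rewrite /lebesgue_stieltjes_measure/measure_extension/=.
by rewrite measurable_mu_extE/= ?wlength_itv_bnd//; exact: is_ocitv.
Qed.

Section StieltjesOfContinuous.
Context {R : realType} (g : R -> R).
Hypotheses (g_nd : nondecreasing g) (g_cont : continuous g).

(** An alias of g on which its monotonicity and continuity are registered as an instance. *)
Definition cumulative_of : R -> R := g.

HB.instance Definition _ :=
  isCumulative.Build R _ R cumulative_of g_nd (right_continuousW g_cont).

Lemma stieltjes_ex : exists m : {measure set (measurableTypeR R) -> \bar R},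
  forall a b, a <= b -> m `]a, b]%classic = (g b - g a)%:E.
Proof.
exists (lebesgue_stieltjes_measure cumulative_of) => a b ab.
exact: lebesgue_stieltjes_measure_itv.
Qed.

End StieltjesOfContinuous.

Lemma ae_imply {R : realType} (P Q : R -> Prop) :
  {ae (@lebesgue_measure R), forall t, P t} -> (forall t, P t -> Q t) ->
  {ae (@lebesgue_measure R), forall t, Q t}.
Proof. by move=> h PQ; apply: (@filterS _ _ (ae_filter_ringOfSetsType _)) h. Qed.

Lemma derive_sub_affine {R : realType} (F phi : R -> R) (L c t : R) :
  derivable F t 1 -> (\forall z \near t, F z = L * z + phi z - c) ->
  derivable phi t 1 /\ 'D_1 phi t = derive1 F t - L.
Proof.
move=> dF near_F.
have dF' : is_derive t 1 F (derive1 F t) by apply: DeriveDef => //; rewrite derive1E.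
have d1 : is_derive t 1 (fun z => L *: (z : R)) (L *: 1).
  by apply: is_deriveZ; exact: is_derive_id.
have d2 := is_deriveD (is_deriveB dF' d1) (is_derive_cst c t 1).
have d3 : is_derive t 1 phi (derive1 F t - L *: 1 + 0).
  apply: near_eq_is_derive d2.
  near=> z; rewrite !fctE (near near_F z)// /GRing.scale/=; lra.
split; first exact: ex_derive.
by rewrite derive_val addr0 /GRing.scale/= mulr1.
Unshelve. all: by end_near. Qed.

Section Lipschitz1.
Context {R : realType}.
Local Notation mu := (@lebesgue_measure R).
Variables (phi : R -> R) (L : R).
Hypotheses (L0 : 0 < L) (phiL : forall s t, `|phi s - phi t| <= L * `|s - t|).

Lemma lipschitz_continuous1 : continuous phi.
Proof.
move=> x; apply/cvgrPdist_le => e e0; near=> t.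
apply: le_trans (phiL _ _) _; rewrite -ler_pdivlMl//.
near: t; have e1 : 0 < L^-1 * e by rewrite mulr_gt0 ?invr_gt0.
have := @cvg_id R (nbhs x) => /cvgrPdist_le/(_ _ e1).
exact.
Unshelve. all: by end_near. Qed.

(** Both L t + phi t and L t - phi t are nondecreasing, and their Stieltjes measures add up to 2 L
    times Lebesgue measure. Hence the first one is absolutely continuous. *)
Lemma stieltjes_lipschitz_ex :
  exists m : {measure set (measurableTypeR R) -> \bar R},
    (forall a b, a <= b -> m `]a, b]%classic = (L * b + phi b - (L * a + phi a))%:E) /\
    (forall A, measurable A -> mu A = 0%E -> m A = 0%E).
Proof.
have cL : continuous (fun t : R => L * t).
  by move=> t; apply: cvgMr; exact: cvg_id.
have nd (e : R) : `|e| = 1 -> nondecreasing (fun t => L * t + e * phi t).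
  move=> e1 s t st; rewrite -subr_ge0.
  have := phiL t s; rewrite [X in _ <= _ * X]ger0_norm ?subr_ge0// => h.
  have : `|e * (phi t - phi s)| <= L * (t - s) by rewrite normrM e1 mul1r.
  by rewrite ler_norml; lra.
have ct (e : R) : continuous (fun t => L * t + e * phi t).
  move=> t; apply: cvgD; first exact: cL.
  by apply: cvgMr; exact: lipschitz_continuous1.
have [m1 m1E] := stieltjes_ex (nd 1 (normr1 _)) (ct 1).
have [m2 m2E] := stieltjes_ex (nd (-1) (normrN1 _)) (ct (-1)).
exists m1; split; first by move=> a b ab; rewrite m1E// !mul1r.
have c0 : 0 <= (2 * L)^-1 by rewrite invr_ge0 mulr_ge0// ltW.
have sE (A : set R) : mscale (NngNum c0) (measure_add m1 m2) A =
    (((2 * L)^-1)%:E * (m1 A + m2 A))%E by rewrite -measure_addE.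
have E (A : set R) : measurable A -> mu A = (((2 * L)^-1)%:E * (m1 A + m2 A))%E.
  move=> mA; rewrite -sE; apply: lebesgue_measure_unique => // _ [[a b]] _ <-.
  apply: etrans (esym (sE _)); rewrite /=.
  have [ab|ba] := leP a b; last first.
    by rewrite set_itv_ge ?measure0 ?adde0 ?mule0// bnd_simp -leNgt ltW.
  rewrite m1E// m2E// lebesgue_measure_itv/= lte_fin -EFinD -EFinM.
  move: ab; rewrite le_eqVlt => /predU1P[->|ab].
    by rewrite ltxx; congr EFin; rewrite !subrr addr0 mulr0.
  by rewrite ab; congr EFin; field; rewrite gt_eqF.
move=> A mA; rewrite E// => /eqP.
rewrite mule_eq0 eqe invr_eq0 mulf_eq0 pnatr_eq0/= gt_eqF//=.
by rewrite padde_eq0// => /andP[/eqP].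
Qed.

(** The Stieltjes measure of L t + phi t has a density. By Lebesgue differentiation, at almost every
    point of ]a, b[ phi is derivable and the density is L + phi'. So the density is at most L + y
    there, and integrating it over ]a, b] bounds the increment. *)
Lemma lipschitz_derive_ub (y a b : R) : 0 <= y -> a < b ->
  {ae mu, forall t, derivable phi t 1 -> 'D_1 phi t <= y} ->
  phi b - phi a <= y * (b - a).
Proof.
move=> y0 ab aey; have [m [mE m0]] := stieltjes_lipschitz_ex.
have mD : measurable (`]a, b]%classic : set (measurableTypeR R)) by exact: measurable_itv.
have moo : (m `]a, b]%classic < +oo)%E by rewrite mE ?ltry// ltW.
(* Restricting to ]a, b] makes the measure finite, so that its density is integrable on the whole
   line. *)
pose nu : {finite_measure set (measurableTypeR R) -> \bar R} := mfrestr mD moo.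
have nuE A : nu A = m (A `&` `]a, b]%classic) by [].
have numu : nu `<< mu.
  apply/null_content_dominatesP => A mA muA.
  apply/eqP; rewrite eq_le measure_ge0 andbT -(m0 A mA muA).
  by apply: le_measure; rewrite ?inE//; exact: measurableI.
have [f [f0 ffin fint fE]] := radon_nikodym_sigma_finite numu.
pose h x := fine (f x).
have fh : EFin \o h = f by apply/funext => x /=; rewrite fineK.
have hint : mu.-integrable setT (EFin \o h) by rewrite fh.
have hloc : locally_integrable setT h by apply: open_integrable_locally => //; exact: openT.
have hI z : mu.-integrable [set` Interval (BRight a) (BRight z)] (EFin \o h).
  by apply: integrableS hint.

have FE z : a < z < b -> (\int[mu]_(t in `]a, z]) h t)%R = L * z + phi z - (L * a + phi a).
  move=> /andP[az zb]; rewrite /Rintegral.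
  have -> : (\int[mu]_(x in `]a, z]) (h x)%:E = \int[mu]_(x in `]a, z]) f x)%E.
    by rewrite -fh.
  rewrite -fE; last exact: measurable_itv.
  rewrite nuE.
  rewrite (_ : `]a, z]%classic `&` `]a, b]%classic = `]a, z]%classic) ?mE ?ltW//.
  apply/seteqP; split => x /=; rewrite !in_itv/=; first by case.
  by move=> /andP[ax xz]; rewrite ax xz (le_trans xz (ltW zb)).
have hub : {ae mu, forall t, `]a, b[%classic t -> (f t <= (L + y)%:E)%E}.
  have := FTC1 hI hloc => /= FF.
  apply: (@filterS2 _ _ (ae_filter_ringOfSetsType _)) aey FF => t phit Ft; rewrite /= in_itv/= => /andP[at_ tb].
  have [dF F't] := Ft at_.
  have near_F : \forall z \near t,
      (\int[mu]_(x in `]a, z]) h x)%R = L * z + phi z - (L * a + phi a).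
    near=> z; apply: FE; apply/andP; split; near: z;
      [exact: lt_nbhsr|exact: lt_nbhsl].
  have [dphi Dphi] := derive_sub_affine dF near_F.
  have := phit dphi; rewrite Dphi F't => hy.
  by rewrite -(fineK (ffin t)) lee_fin -/(h t); lra.
have : (nu `]a, b]%classic <= ((L + y) * (b - a))%:E)%E.
  rewrite fE; last exact: measurable_itv.
  rewrite -(@integral_itv_bndo_bndc _ (BRight a)); last first.
    by apply: measurable_funTS; exact: measurable_int fint.
  apply: le_trans (ae_ge0_le_integral _ _ _ _ _ hub) _ => //.
  - by apply: measurable_funTS; exact: measurable_int fint.
  - by move=> x _; rewrite lee_fin addr_ge0// ltW.
  rewrite integral_cst; last exact: measurable_itv.
  by rewrite /= lebesgue_measure_itv/= lte_fin ab -EFinB -EFinM.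
rewrite nuE setIid (mE _ _ (ltW ab)) lee_fin; lra.
Unshelve. all: by end_near. Qed.

End Lipschitz1.

Lemma lipschitz_derive_bound {R : realType} (phi : R -> R) (L y : R) : 0 <= y ->
  (forall s t, `|phi s - phi t| <= L * `|s - t|) ->
  {ae lebesgue_measure, forall t, derivable phi t 1 -> `|'D_1 phi t| <= y} ->
  forall s t, `|phi s - phi t| <= y * `|s - t|.
Proof.
move=> y0 phiL aey.
have L1 : 0 < `|L| + 1 by rewrite ltr_wpDl.
have phiL1 s t : `|phi s - phi t| <= (`|L| + 1) * `|s - t|.
  by apply: le_trans (phiL s t) _; rewrite ler_wpM2r// (le_trans (ler_norm _))// lerDl.
have phiL2 s t : `|(- phi) s - (- phi) t| <= (`|L| + 1) * `|s - t|.
  by rewrite !fctE -opprD normrN.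
have ub a b : a < b -> phi b - phi a <= y * (b - a).
  move=> ab; apply: (lipschitz_derive_ub L1 phiL1) => //.
  apply: ae_imply aey _ => t h /h; exact: le_trans (ler_norm _).
have lb a b : a < b -> - phi b + phi a <= y * (b - a).
  move=> ab; have := @lipschitz_derive_ub _ (- phi) _ L1 phiL2 y a b y0 ab.
  rewrite !fctE opprK; apply.
  apply: ae_imply aey _ => t h dt.
  have dphi : derivable phi t 1 by rewrite -(opprK phi); exact: derivableN.
  by rewrite deriveN//; apply: le_trans (h dphi); rewrite -normrN ler_norm.
have main a b : a < b -> `|phi b - phi a| <= y * `|b - a|.
  move=> ab; have ab0 : 0 <= b - a by rewrite subr_ge0 ltW.
  rewrite (ger0_norm ab0).
  rewrite ler_norml; have := ub _ _ ab; have := lb _ _ ab; lra.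
move=> s t; have [st|ts|->] := ltgtP s t.
- by rewrite distrC [X in _ <= _ * X]distrC; exact: main.
- exact: main.
- by rewrite !subrr normr0 mulr0.
Qed.

(** * Directional Lipschitz constants *)

Section Enorm.
Context {R : realType} {n : nat}.
Implicit Types (x y : 'rV[R]_n) (c : R).

Lemma enorm_ge0 x : 0 <= enorm x. Proof. exact: sqrtr_ge0. Qed.

Lemma enorm_sqr x : enorm x ^+ 2 = \sum_i x 0 i ^+ 2.
Proof. by rewrite sqr_sqrtr// sumr_ge0// => i _; rewrite sqr_ge0. Qed.

Lemma enormZ c x : enorm (c *: x) = `|c| * enorm x.
Proof.
rewrite /enorm -sqrtr_sqr -sqrtrM ?sqr_ge0// mulr_sumr; congr Num.sqrt.
by apply: eq_bigr => i _; rewrite mxE exprMn.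
Qed.

Lemma enormN x : enorm (- x) = enorm x.
Proof. by rewrite -scaleN1r enormZ normrN1 mul1r. Qed.

Lemma enorm_eq0 x : (enorm x == 0) = (x == 0).
Proof.
apply/eqP/eqP => [x0|->]; last first.
  by rewrite -(scale0r 0) enormZ normr0 mul0r.
have := enorm_sqr x; rewrite x0 expr0n/= => /esym/eqP.
rewrite psumr_eq0; last by move=> i _; rewrite sqr_ge0.
move=> /allP h; apply/rowP => i; rewrite mxE.
by have := h i; rewrite mem_index_enum sqrf_eq0 => /(_ isT)/eqP.
Qed.

Lemma enorm0 : enorm (0 : 'rV[R]_n) = 0.
Proof. by apply/eqP; rewrite enorm_eq0. Qed.

Lemma enorm_gt0 x : (0 < enorm x) = (x != 0).
Proof. by rewrite lt_neqAle enorm_ge0 andbT eq_sym enorm_eq0. Qed.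

Lemma cauchy_schwarz_sum x y : \sum_i x 0 i * y 0 i <= enorm x * enorm y.
Proof.
have [->|x0] := eqVneq x 0.
  by rewrite enorm0 mul0r big1// => i _; rewrite mxE mul0r.
have [->|y0] := eqVneq y 0.
  by rewrite enorm0 mulr0 big1// => i _; rewrite mxE mulr0.
rewrite -enorm_gt0 in x0; rewrite -enorm_gt0 in y0.
set a := enorm x in x0 *; set b := enorm y in y0 *.
have : 0 <= \sum_i (b * x 0 i - a * y 0 i) ^+ 2 by apply: sumr_ge0 => i _; exact: sqr_ge0.
have -> : \sum_i (b * x 0 i - a * y 0 i) ^+ 2 =
    2 * (a * b) * (a * b - \sum_i x 0 i * y 0 i).
  transitivity (b ^+ 2 * \sum_i x 0 i ^+ 2 + a ^+ 2 * \sum_i y 0 i ^+ 2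
     - 2 * (a * b) * \sum_i x 0 i * y 0 i).
    rewrite !mulr_sumr -big_split/= -sumrB; apply: eq_bigr => i _; ring.
  by rewrite -!enorm_sqr -/a -/b; ring.
by rewrite pmulr_rge0 ?subr_ge0// !mulr_gt0.
Qed.

Lemma ler_enormD x y : enorm (x + y) <= enorm x + enorm y.
Proof.
rewrite -ler_sqr ?nnegrE ?addr_ge0 ?enorm_ge0// sqrrD !enorm_sqr.
have := cauchy_schwarz_sum x y.
have -> : \sum_i (x + y) 0 i ^+ 2 =
    \sum_i x 0 i ^+ 2 + 2 * (\sum_i x 0 i * y 0 i) + \sum_i y 0 i ^+ 2.
  by rewrite mulr_sumr -!big_split/=; apply: eq_bigr => i _; rewrite mxE; ring.
by rewrite -mulr_natl; lra.
Qed.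

Lemma enorm_le_sum x : enorm x <= \sum_i `|x 0 i|.
Proof.
have s0 : 0 <= \sum_i `|x 0 i| by apply: sumr_ge0.
rewrite -ler_sqr ?nnegrE ?enorm_ge0// enorm_sqr expr2 mulr_suml.
apply: ler_sum => i _; rewrite -real_normK ?num_real// expr2 ler_wpM2l//.
by rewrite (bigD1 i)//= lerDl sumr_ge0.
Qed.

Lemma dense_rat x (e : R) : 0 < e ->
  exists q : 'rV[rat]_n, enorm (x - \row_i ratr (q 0 i)) < e.
Proof.
(* The added 1 keeps the divisor positive when n = 0 and makes n d < e strict. *)
move=> e0; pose d := e / (n%:R + 1).
have n1 : 0 < n%:R + 1 :> R by rewrite ltr_wpDl.
have d0 : 0 < d by rewrite divr_gt0.
have H i : exists q : rat, `|x 0 i - ratr q| < d.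
  have [|q] := @rat_in_itvoo R (x 0 i - d) (x 0 i + d); first by lra.
  rewrite in_itv/= => qd; exists q; rewrite ltr_norml; lra.
exists (\row_i sval (cid (H i))).
apply: le_lt_trans (enorm_le_sum _) _.
apply: (@le_lt_trans _ _ (\sum_(i < n) d)).
  by apply: ler_sum => i _; rewrite !mxE; case: cid => q /= /ltW.
rewrite sumr_const card_ord -mulr_natl /d mulrA ltr_pdivrMr// mulrDr mulr1.
by rewrite [e * _]mulrC ltrDl.
Qed.

End Enorm.

Section LipschitzMeasurable.
Context {R : realType} {n : nat}.
Local Notation MR := (measurableTypeR R).

Definition rv_measurableR (g : 'rV[R]_n -> R) :=
  measurable_fun [set: n.-tuple MR] (g \o @rv_of_tuple R n).

Lemma rv_measurable_EFin (g : 'rV[R]_n -> R) :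
  rv_measurableR g -> rv_measurable (EFin \o g).
Proof. by move=> mg; apply/measurable_EFinP. Qed.

Lemma measurable_enormB (a : 'rV[R]_n) : rv_measurableR (fun x => enorm (x - a)).
Proof.
rewrite /rv_measurableR.
have -> : (fun x => enorm (x - a)) \o @rv_of_tuple R n =
    Num.sqrt \o (fun t : n.-tuple MR => \sum_i (tnth t i - a 0 i) ^+ 2).
  by apply/funext => t /=; congr Num.sqrt; apply: eq_bigr => i _; rewrite !mxE.
apply: measurableT_comp; first by apply: continuous_measurable_fun; exact: sqrt_continuous.
apply: measurable_sum => i; apply: measurable_funX.
by apply: measurable_funB => //; exact: measurable_tnth.
Qed.

Lemma lipschitz_Rn_ge0 (f : 'rV[R]_n -> R) : lipschitz_Rn f ->
  exists2 L : R, 0 < L & forall x y, `|f x - f y| <= L * enorm (x - y).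
Proof.
move=> [L fL]; exists (`|L| + 1) => [|x y]; first by rewrite ltr_wpDl.
apply: le_trans (fL x y) _; rewrite ler_wpM2r ?enorm_ge0//.
by rewrite (le_trans (ler_norm _))// lerDl.
Qed.

(* McShane: a Lipschitz function is the infimum of the cones based on its values
   at the rational points, hence a countable infimum of measurable functions. *)
Lemma lipschitz_measurable (f : 'rV[R]_n -> R) : lipschitz_Rn f -> rv_measurableR f.
Proof.
move=> /lipschitz_Rn_ge0[L L0 fL].
(* The default vertex 0 for codes that decode to nothing is harmless, since a cone based at any
   point lies above f. *)
pose q_ m : 'rV[R]_n := if unpickle m is Some q then \row_i ratr ((q : 'rV[rat]_n) 0 i) else 0.
pose h m x := f (q_ m) + L * enorm (x - q_ m).
have mh m : rv_measurableR (h m).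
  apply: measurable_funD => //; apply: measurable_funM => //.
  exact: measurable_enormB.
have fE (c : R) : [set t | (f \o @rv_of_tuple R n) t < c] =
    \bigcup_m [set t | (h m \o @rv_of_tuple R n) t < c].
  apply/seteqP; split => t /=.
    set x := rv_of_tuple t => fc.
    (* At this distance the cone at the rational point has value at most f x + 2 L |x - q| < c at x:
       one half pays for the change of f, the other for the cone. *)
    have e0 : 0 < (c - f x) / (2 * L) by rewrite divr_gt0 ?subr_gt0 ?mulr_gt0.
    have [q qx] := dense_rat x e0.
    exists (pickle q) => //=; rewrite /h /q_ pickleK.
    set y := \row_i _ in qx *.
    have := fL y x; rewrite -(enormN (y - x)) opprB => /ler_normlW h1.
    have h2 : L * enorm (x - y) < (c - f x) / 2.
      by rewrite -ltr_pdivlMl//; apply: lt_le_trans qx _; rewrite invfM; lra.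
    rewrite -/x; lra.
  move=> [m _ /=]; apply: le_lt_trans; rewrite /h.
  set x := rv_of_tuple t; have /ler_normlW := fL x (q_ m); lra.
move=> mD; apply: (measurability _ (RGenInftyO.measurableE R)) => //.
move=> _ [_ [c ->] <-]; rewrite setTI.
have -> : (f \o @rv_of_tuple R n) @^-1` `]-oo, c[ =
    [set t | (f \o @rv_of_tuple R n) t < c].
  by apply/seteqP; split => t /=; rewrite in_itv.
rewrite fE; apply: bigcupT_measurable => m.
by apply: measurable_set_bool; apply: measurable_fun_ltr => //; exact: mh.
Qed.

End LipschitzMeasurable.

(** * Null sets and their traces on lines *)

Section Null.
Context {R : realType}.
Local Notation mu := (@lebesgue_measure R).
Local Notation MR := (measurableTypeR R).

Lemma ge0_integral_eq0 d (T : measurableType d) (m : {measure set T -> \bar R})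
    (f : T -> \bar R) : measurable_fun [set: T] f -> (forall x, 0 <= f x)%E ->
  (\int[m]_x f x = 0)%E -> m [set x | (f x != 0)%E] = 0%E.
Proof.
move=> mf f0 If.
have mA : measurable [set x | (f x != 0)%E].
  have -> : [set x | (f x != 0)%E] = [set x | (0 < f x)%E].
    by apply/seteqP; split => x /=; rewrite lt0e f0 andbT.
  apply: measurable_set_bool; apply: measurable_fun_lte => //.
have : (\int[m]_(x in setT) `|f x| = 0)%E.
  by rewrite -[RHS]If; apply: eq_integral => x _; rewrite gee0_abs.
move=> /(ae_eq_integral_abs _ measurableT mf) [N [mN N0 sN]].
apply/eqP; rewrite eq_le measure_ge0 andbT.
apply: (@le_trans _ _ (m N)); last by rewrite N0.
apply: le_measure; rewrite ?inE// => x /= fx.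
by apply: sN => /= h; move: fx; rewrite h// eqxx.
Qed.

(** The zeros of a nonnegative function with zero integral are dense. One coordinate is chosen at a
    time: the inner integral vanishes almost everywhere, hence somewhere in any ball around the
    prescribed coordinate. *)
Lemma iint_seq_eq0_dense n (g : seq R -> \bar R) (a : seq R) (e : R) :
  (forall s, 0 <= g s)%E -> seq_measurable n g -> iint_seq n g = 0%E -> 0 < e ->
  exists s, [/\ size s = n, (forall i, (i < n)%N -> `|nth 0 s i - nth 0 a i| < e)
    & g s = 0%E].
Proof.
move=> + + + e0; elim: n g a => [|n IH] g a g0 mg /= Ig; first by exists [::].
have mG := measurable_iint_seq_cons g0 mg.
have G0 t : (0 <= iint_seq n (fun s => g (t :: s)))%E by exact: iint_seq_ge0.
have N0 := @ge0_integral_eq0 _ MR mu (fun t => iint_seq n (fun s => g (t :: s))) mG G0 Ig.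
have [t ta Gt] : exists2 t, `|t - nth 0 a 0| < e & iint_seq n (fun s => g (t :: s)) = 0%E.
  apply: contrapT => H.
  have : (mu (ball (nth 0 a 0)%R e) <= 0)%E.
    rewrite -[leRHS]N0; apply: le_measure; rewrite ?inE//.
    - exact: measurable_ball.
    - have -> : [set x | (iint_seq n (fun s => g (x :: s)) != 0)%E] =
          [set x | (0 < iint_seq n (fun s => g (x :: s)))%E].
        by apply/seteqP; split => x /=; rewrite lt0e G0 andbT.
      by apply: measurable_set_bool; apply: measurable_fun_lte.
    - move=> t; rewrite /ball/= => ta; apply/eqP => Gt; apply: H.
      by exists t; rewrite // distrC.
  rewrite (lebesgue_measure_ball _ (ltW e0)) lee_fin; lra.
have [s [sn sa gs]] := IH _ (behead a) (fun s => g0 (t :: s)) (seq_measurable_cons t mg) Gt.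
exists (t :: s); split => //=; first by rewrite sn.
by case=> [|i] //= ni; have := sa i ni; rewrite nth_behead.
Qed.

Lemma leb_int_eq0_dense n (g : 'rV[R]_n -> \bar R) (a : 'rV[R]_n) (e : R) :
  (forall x, 0 <= g x)%E -> rv_measurable g -> leb_int g = 0%E -> 0 < e ->
  exists2 x, enorm (x - a) < e & g x = 0%E.
Proof.
move=> g0 mg Ig e0; pose d := e / (n%:R + 1).
have n1 : 0 < n%:R + 1 :> R by rewrite ltr_wpDl.
have d0 : 0 < d by rewrite divr_gt0.
have [s [sn sa gs]] := iint_seq_eq0_dense [seq a 0 i | i <- enum 'I_n]
  (fun s => g0 _) (rv_seq_measurable mg) Ig d0.
exists (row_of_seq n s) => //; apply: le_lt_trans (enorm_le_sum _) _.
apply: (@le_lt_trans _ _ (\sum_(i < n) d)).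
  apply: ler_sum => i _; rewrite !mxE ltW//; have := sa i (ltn_ord i).
  by rewrite (nth_map i) ?size_enum_ord// nth_ord_enum.
rewrite sumr_const card_ord -mulr_natl /d mulrA ltr_pdivrMr// mulrDr mulr1.
by rewrite [e * _]mulrC ltrDl.
Qed.

Lemma measurable_rv_line n (v : 'rV[R]_n) (N : set 'rV[R]_n) : lmeasurable N ->
  measurable [set p : n.-tuple MR * MR | N (rv_of_tuple p.1 + (p.2 : R) *: v)].
Proof.
move=> mN.
pose T (p : n.-tuple MR * MR) : n.-tuple MR :=
  [tuple tnth p.1 i + (p.2 : R) * v 0 i | i < n].
have mT : measurable_fun setT T.
  apply/measurable_fun_tnthP => i.
  rewrite (_ : _ \o T = fun p => tnth p.1 i + (p.2 : R) * v 0 i); last first.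
    by apply/funext => p /=; rewrite tnth_mktuple.
  apply: measurable_funD.
    by apply: (measurableT_comp (measurable_tnth i)).
  by apply: measurable_funM => //; exact: measurable_snd.
have := mT measurableT _ mN; rewrite setTI.
congr measurable; apply/seteqP; split => p /=; congr N;
  by apply/rowP => i; rewrite !mxE tnth_mktuple.
Qed.

(** Almost every line parallel to v meets N in a null set. By Tonelli the x-integral may be taken
    first, and for each r it is the measure of the translate N - r v. *)
Lemma lnull_line n (v : 'rV[R]_n) (N : set 'rV[R]_n) : lnull N ->
  let G (x : 'rV[R]_n) := mu [set r : R | N (x + r *: v)] in
  rv_measurable G /\ leb_int G = 0%E.
Proof.
move=> [mN N0] G; have mB := measurable_rv_line v mN.
set B := (X in measurable X) in mB.
have GE : G \o @rv_of_tuple R n = mu \o xsection B.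
  by apply/funext => t; rewrite /G /= xsectionE.
have mG : rv_measurable G.
  by rewrite /rv_measurable GE; exact: measurable_fun_xsection.
split=> //; rewrite leb_intE//.
have := @indic_fubini_tonelli _ _ _ _ _ (lebesgue_n n) mu _ mB.
rewrite indic_fubini_tonelli_FE// indic_fubini_tonelli_GE// => E.
transitivity (\int[lebesgue_n n]_t (mu \o xsection B) t)%E.
  by apply: eq_integral => t _; rewrite -GE.
rewrite E; apply: integral0_eq => r _ /=; rewrite ysectionE.
have m1 : rv_measurable (fun x => (\1_N x)%:E : \bar R).
  by apply/measurable_EFinP; exact: (measurable_indic mN).
have := @leb_int_affine R n 1 (r *: v) (fun x => (\1_N x)%:E) ltr01 (fun x => _) m1.
rewrite N0 mule0 => H; rewrite -[RHS]H; last by move=> x; rewrite lee_fin.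
rewrite leb_intE; last 2 first.
- by move=> x; rewrite lee_fin.
- have mBr : measurable (ysection B r) by exact: measurable_ysection.
  have /measurable_EFinP : measurable_fun [set: n.-tuple MR] (\1_(ysection B r) : _ -> R).
    exact: measurable_indic.
  apply: eq_measurable_fun => t _ /=; rewrite ysectionE scale1r.
  by rewrite !indicE.
rewrite -[X in lebesgue_n n X = _]setIT -integral_indic//; last first.
  by rewrite -ysectionE; exact: measurable_ysection.
by apply: eq_integral => t _; rewrite scale1r !indicE.
Qed.

End Null.

Section DirLip.
Context {R : realType} {n : nat}.
Local Notation mu := (@lebesgue_measure R).
Implicit Types (f : 'rV[R]_n -> R) (v w x : 'rV[R]_n).

(* the quotients with t = 0 are 0 / 0 = 0 *)
Definition dir_lip f v : R :=
  sup [set `|f (p.1 + p.2 *: v) - f p.1| / `|p.2| | p in [set: 'rV[R]_n * R]].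

Section Lip.
Variables (f : 'rV[R]_n -> R) (L : R).
Hypotheses (L0 : 0 < L) (fL : forall x y, `|f x - f y| <= L * enorm (x - y)).

Lemma dir_lip_quotient v x t : `|f (x + t *: v) - f x| / `|t| <= L * enorm v.
Proof.
have [->|t0] := eqVneq t 0.
  by rewrite normr0 invr0 mulr0 mulr_ge0 ?enorm_ge0// ltW.
rewrite ler_pdivrMr ?normr_gt0//; apply: le_trans (fL _ _) _.
by rewrite addrAC subrr add0r enormZ -mulrA [enorm v * _]mulrC.
Qed.

Lemma dir_lip_has_sup v :
  has_sup [set `|f (p.1 + p.2 *: v) - f p.1| / `|p.2| | p in [set: 'rV[R]_n * R]].
Proof.
split; first by exists (`|f (0 + 0 *: v) - f 0| / `|0 : R|); exists (0, 0).
by exists (L * enorm v) => _ [p _ <-]; exact: dir_lip_quotient.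
Qed.

Lemma dir_lipP v x t : `|f (x + t *: v) - f x| <= dir_lip f v * `|t|.
Proof.
have [->|t0] := eqVneq t 0.
  by rewrite scale0r addr0 subrr normr0 mulr0.
rewrite -ler_pdivrMr ?normr_gt0//.
by apply: ub_le_sup; [case: (dir_lip_has_sup v)|exists (x, t)].
Qed.

Lemma dir_lip_le v y : 0 <= y ->
  (forall x t, `|f (x + t *: v) - f x| <= y * `|t|) -> dir_lip f v <= y.
Proof.
move=> y0 H; apply: ge_sup; first by case: (dir_lip_has_sup v).
move=> _ [[x t] _ <-] /=.
have [->|t0] := eqVneq t 0; first by rewrite normr0 invr0 mulr0.
by rewrite ler_pdivrMr ?normr_gt0.
Qed.

Lemma dir_lip_ge0 v : 0 <= dir_lip f v.
Proof. by have := dir_lipP v 0 1; rewrite normr1 mulr1; exact: le_trans. Qed.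

Lemma dir_lip_le_enorm v : dir_lip f v <= L * enorm v.
Proof.
apply: dir_lip_le => [|x t]; first by rewrite mulr_ge0 ?enorm_ge0// ltW.
apply: le_trans (fL _ _) _.
by rewrite addrAC subrr add0r enormZ -mulrA [enorm v * _]mulrC.
Qed.

Lemma dir_lipD v w : dir_lip f (v + w) <= dir_lip f v + dir_lip f w.
Proof.
apply: dir_lip_le => [|x t]; first by rewrite addr_ge0 ?dir_lip_ge0.
rewrite scalerDr addrA mulrDl.
have := dir_lipP v x t; have := dir_lipP w (x + t *: v) t.
set a := f (_ + _ + _); set b := f (x + _); move=> h1 h2.
rewrite -(subrK b a) -addrA.
rewrite [leRHS]addrC; exact: le_trans (ler_normD _ _) (lerD h1 h2).
Qed.

Lemma dir_lipZ_le c v : dir_lip f (c *: v) <= `|c| * dir_lip f v.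
Proof.
apply: dir_lip_le => [|x t]; first by rewrite mulr_ge0 ?dir_lip_ge0.
rewrite scalerA; apply: le_trans (dir_lipP _ _ _) _.
by rewrite normrM le_eqVlt; apply/orP; left; apply/eqP; ring.
Qed.

Lemma dir_lipZ c v : dir_lip f (c *: v) = `|c| * dir_lip f v.
Proof.
apply/eqP; rewrite eq_le dir_lipZ_le/=.
have [->|c0] := eqVneq c 0; first by rewrite normr0 mul0r dir_lip_ge0.
rewrite -ler_pdivlMl ?normr_gt0// -normfV.
by apply: le_trans (dir_lipZ_le _ _); rewrite scalerA mulVf// scale1r.
Qed.

Lemma lipschitz_dir_lip : lipschitz_Rn (dir_lip f).
Proof.
have H v w : dir_lip f v - dir_lip f w <= L * enorm (v - w).
  apply: le_trans (dir_lip_le_enorm (v - w)); rewrite lerBlDr.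
  by apply: le_trans (dir_lipD _ _); rewrite subrK.
exists L => v w; rewrite ler_norml H andbT.
by have := H w v; rewrite -enormN opprB; lra.
Qed.

Lemma derive_dir_lip x v : `|'D_v f x| <= dir_lip f v.
Proof.
(* Where the limit does not exist, [derive] takes the default value 0. *)
have [df|ndf] := pselect (derivable f x v); last first.
  by rewrite /derive dvgP// normr0 dir_lip_ge0.
have /cvg_norm H : (h^-1 *: ((f \o shift x) (h *: v) - f x)) @[h --> 0^'] --> 'D_v f x.
  exact: df.
apply: (cvgr_to_le H); near=> h.
have h0 : h != 0 by near: h; exact: nbhs_dnbhs_neq.
rewrite /= normrZ normfV ler_pdivrMl ?normr_gt0//.
by rewrite [h *: v + x]addrC mulrC; exact: dir_lipP.
Unshelve. all: by end_near. Qed.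

Lemma derive_line x v r : 'D_1 (fun s : R => f (x + s *: v)) r = 'D_v f (x + r *: v).
Proof.
rewrite /derive.
suff -> : (fun h : R => h^-1 *: (((fun s : R => f (x + s *: v)) \o shift r) (h *: 1) -
    f (x + r *: v))) = (fun h : R => h^-1 *: ((f \o shift (x + r *: v)) (h *: v) -
    f (x + r *: v))) by [].
apply/funext => h /=; congr (_ *: (f _ - _)).
by rewrite scalerDl addrCA /GRing.scale/= mulr1.
Qed.

Lemma lipschitz_along_line x v (N : set 'rV[R]_n) y : 0 <= y -> lmeasurable N ->
  [set z | ~ `|'D_v f z| <= y] `<=` N -> mu [set r : R | N (x + r *: v)] = 0%E ->
  forall t, `|f (x + t *: v) - f x| <= y * `|t|.
Proof.
move=> y0 mN fN Nx t.
have mNx : measurable [set r : R | N (x + r *: v)].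
  have := measurable_xsection [tuple x 0 i | i < n] (measurable_rv_line v mN).
  rewrite xsectionE; congr measurable; apply/seteqP; split => r /=; congr N;
    by congr (_ + _); apply/rowP => i; rewrite !mxE tnth_mktuple.
have H := @lipschitz_derive_bound R (fun s => f (x + s *: v)) (L * enorm v) y y0.
have /= := H _ _ t 0; rewrite scale0r addr0 subr0; apply.
  move=> s1 s2; apply: le_trans (fL _ _) _.
  by rewrite opprD addrACA subrr add0r -scalerBl enormZ -mulrA [enorm v * _]mulrC.
exists [set r : R | N (x + r *: v)]; split => // r /= hr; apply: fN => /= Dr.
by apply: hr => _; rewrite derive_line.
Qed.

End Lip.

Lemma lnull_set0 : lnull (set0 : set 'rV[R]_n).
Proof.
split; first by rewrite /lmeasurable preimage_set0; exact: measurable0.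
rewrite leb_intE.
- by apply: integral0_eq => t _; rewrite indic0.
- by move=> x; rewrite lee_fin.
- by apply: rv_measurable_EFin; rewrite /rv_measurableR indic0; exact: measurable_cst.
Qed.

(** The derivative is bounded by [dir_lip] everywhere. Conversely, a bound y valid off a null set N
    gives increments at most y |t| along each line that meets N in a null set; such lines pass
    arbitrarily close to any point, and the Lipschitz bound transfers the estimate. *)
Lemma dir_deriv_LinfE f v : lipschitz_Rn f -> dir_deriv_Linf f v = (dir_lip f v)%:E.
Proof.
move=> /lipschitz_Rn_ge0[L L0 fL]; apply/eqP; rewrite eq_le; apply/andP; split.
  apply: ereal_inf_lbound; exists set0; split; first exact: lnull_set0.
  by move=> x /=; apply; rewrite lee_fin; exact: (derive_dir_lip L0 fL).
apply: le_ereal_inf_tmp => y [N [Nnull sN]].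
have [mG IG] := lnull_line v Nnull.
have dense x e := @leb_int_eq0_dense R n _ x e (fun x => measure_ge0 _ _) mG IG.
have muT : mu [set: R] = +oo%E by rewrite -set_itvNyy lebesgue_measure_itv.
(* One point where the bound holds excludes y = -oo and gives y >= 0. It exists because a line,
   having infinite measure, cannot lie in N when its trace there is null. *)
have [z hz] : exists z, (`|'D_v f z|%:E <= y)%E.
  have [x _ Nx] := dense 0 1 ltr01.
  apply: contrapT => H; move: Nx.
  rewrite (_ : [set r : R | _] = setT).
    by move=> Nx; have := etrans (esym muT) Nx.
  by apply/seteqP; split => // r _ /=; apply: sN => /= h; apply: H; exists (x + r *: v).
case: y sN hz => [y| |] sN hz; [|by rewrite leey|by rewrite leeNy_eq in hz].
have y0 : 0 <= y by rewrite -lee_fin; apply: le_trans hz; rewrite lee_fin.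
rewrite lee_fin; apply: (dir_lip_le L0 fL) => // x t.
apply/ler_addgt0Pr => e e0.
(* Both endpoints of the segment are moved, each changing f by at most e / 2. *)
have e1 : 0 < e / (2 * L) by rewrite divr_gt0// mulr_gt0.
have [z' zx Nz] := dense x _ e1.
have sN' : [set w | ~ `|'D_v f w| <= y] `<=` N.
  by move=> w /= h; apply: sN => /=; rewrite lee_fin.
have h := lipschitz_along_line fL y0 Nnull.1 sN' Nz t.
have h1 : `|f x - f z'| <= e / 2.
  rewrite distrC; apply: le_trans (fL _ _) _; rewrite -ler_pdivlMl//.
  by rewrite ltW//; apply: lt_le_trans zx _; rewrite invfM; lra.
have h2 : `|f (x + t *: v) - f (z' + t *: v)| <= e / 2.
  rewrite distrC; apply: le_trans (fL _ _) _; rewrite -ler_pdivlMl//.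
  rewrite opprD addrACA subrr addr0.
  by rewrite ltW//; apply: lt_le_trans zx _; rewrite invfM; lra.
move: h h1 h2; rewrite !ler_norml; lra.
Qed.

End DirLip.

(** * Radial integrals *)

Section Integrals1D.
Context {R : realType}.
Local Notation mu := (@lebesgue_measure R).

Lemma ge0_FTC2y (f F : R -> R) (a : R) : (forall x, a <= x -> 0 <= f x) ->
  (forall x, a <= x -> {for x, continuous f}) ->
  (forall x, a <= x -> derivable F x 1 /\ 'D_1 F x = f x) -> F x @[x --> +oo] --> 0 ->
  (\int[mu]_(x in `[a, +oo[) (f x)%:E = (- F a)%:E)%E.
Proof.
move=> f0 cf dF Flim.
rewrite (@ge0_continuous_FTC2y _ f F a 0)//.
- by rewrite add0e.
- apply: continuous_in_subspaceT => x; rewrite inE/= in_itv/= andbT; exact: cf.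
- by move=> x ax; case: (dF x (ltW ax)).
- apply: cvg_at_right_filter.
  have [d _] := dF a (lexx a).
  by apply: differentiable_continuous; apply/derivable1_diffP.
- by move=> x; rewrite in_itv/= andbT => ax; rewrite derive1E; case: (dF x (ltW ax)).
Qed.

Lemma is_derive_Xn n (x : R) : is_derive x 1 (fun y : R => y ^+ n.+1) (n.+1%:R * x ^+ n).
Proof.
have := @is_deriveX _ _ id n.+1 x 1 1 (is_derive_id _ _).
by rewrite exprfctE /GRing.scale/= mulr1.
Qed.

(** For x > 0 the bound e^x >= x^(n+1) / (n+1)! gives x^n e^(-x) <= (n+1)! / x. *)
Lemma cvg_Xn_expRN n : x ^+ n * expR (- x) @[x --> +oo%R] --> (0 : R).
Proof.
have inv0 : ((n.+1)`!%:R * x^-1 : R) @[x --> +oo%R] --> (0 : R).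
  rewrite -(mulr0 (n.+1)`!%:R); apply: cvgMr.
  by apply/gtr0_cvgV0; [exact: nbhs_pinfty_gt|exact: cvg_id].
apply: squeeze_cvgr (cvg_cst 0) inv0; near=> x.
have x0 : 0 < x by near: x; exact: nbhs_pinfty_gt.
apply/andP; split; first by rewrite mulr_ge0 ?expR_ge0// exprn_ge0// ltW.
rewrite expRN ler_pdivrMr ?expR_gt0// mulrAC ler_pdivlMr// -exprSr.
rewrite -ler_pdivrMl ?ltr0n ?fact_gt0// mulrC.
by apply: le_trans (expR_ge1Dxn n (ltW x0)); rewrite lerDr.
Unshelve. all: by end_near. Qed.

(* [- gamma_poly n x * exp (- x)] is the primitive of [x ^ n * exp (- x)]
   vanishing at infinity. *)
Fixpoint gamma_poly (n : nat) (x : R) : R :=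
  if n is m.+1 then x ^+ m.+1 + m.+1%:R * gamma_poly m x else 1.

Lemma gamma_poly0 n : gamma_poly n 0 = n`!%:R.
Proof. by elim: n => //= n ->; rewrite expr0n/= add0r factS natrM. Qed.

Lemma is_derive_gamma_poly n (x : R) :
  is_derive x 1 (gamma_poly n) (gamma_poly n x - x ^+ n).
Proof.
elim: n => [|n IH] /=; first by rewrite subrr; exact: is_derive_cst.
have d := is_deriveD (is_derive_Xn n x) (is_deriveM (is_derive_cst (n.+1%:R : R) x 1) IH).
by apply: is_derive_eq d _; rewrite /GRing.scale/=; ring.
Qed.

Lemma cvg_gamma_poly n : gamma_poly n x * expR (- x) @[x --> +oo] --> 0.
Proof.
elim: n => [|n IH] /=.
  by under eq_fun do rewrite mul1r; exact: cvgr_expR.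
under eq_fun do rewrite mulrDl -mulrA.
rewrite -[0]addr0; apply: cvgD; first exact: cvg_Xn_expRN.
by rewrite -(mulr0 n.+1%:R); exact: cvgMr.
Qed.

Lemma integral_Xn_expRN n (s : R) : 0 <= s ->
  (\int[mu]_(x in `[s, +oo[) (x ^+ n * expR (- x))%:E =
   (gamma_poly n s * expR (- s))%:E)%E.
Proof.
move=> s0.
rewrite (@ge0_FTC2y (fun x => x ^+ n * expR (- x)) (fun x => - (gamma_poly n x * expR (- x))))//.
- by rewrite opprK.
- by move=> x sx; rewrite mulr_ge0 ?expR_ge0// exprn_ge0// (le_trans s0).
- move=> x _; apply: cvgM; first exact: exprn_continuous.
  by apply: continuous_comp; [exact: opp_continuous|exact: continuous_expR].
- move=> x _; have dg := is_derive_gamma_poly n x.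
  have de : is_derive x 1 (fun y : R => expR (- y)) (- expR (- x)).
    have := is_derive1_comp (is_derive_expR (- x)) (is_deriveNid x 1).
    by rewrite mulrN1.
  have d := is_deriveN (is_deriveM dg de).
  have {}d : is_derive x 1 (fun y => - (gamma_poly n y * expR (- y))) (x ^+ n * expR (- x)).
    by apply: is_derive_eq d _; rewrite /GRing.scale/=; ring.
  by case: d.
- by rewrite -oppr0; apply: cvgN; exact: cvg_gamma_poly.
Qed.

Lemma integral_Xn n (c : R) : 0 <= c ->
  (\int[mu]_(x in `[0%R, c]) (x ^+ n)%:E = (c ^+ n.+1 / n.+1%:R)%:E)%E.
Proof.
rewrite le_eqVlt => /predU1P[<-|c0].
  by rewrite set_itv1 integral_set1 expr0n/= mul0r.
have dF (x : R) : is_derive x 1 (fun x : R => x ^+ n.+1 / n.+1%:R) (x ^+ n).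
  have d := is_deriveM (is_derive_Xn n x) (is_derive_cst (n.+1%:R^-1 : R) x 1).
  apply: is_derive_eq d _; rewrite /GRing.scale/= mulr0 add0r mulrA mulVf ?mul1r//.
rewrite (@continuous_FTC2 _ _ (fun x => x ^+ n.+1 / n.+1%:R))//.
- by rewrite expr0n/= mul0r sube0.
- by apply: continuous_subspaceT => x; exact: exprn_continuous.
- have cF x : {for x, continuous (fun x : R => x ^+ n.+1 / n.+1%:R)}.
    by apply: cvgMl; exact: exprn_continuous.
  split; first by move=> x _; case: (dF x).
    by apply: cvg_at_right_filter; exact: cF.
  by apply: cvg_at_left_filter; exact: cF.
- by move=> x _; rewrite derive1E; case: (dF x).
Qed.

Lemma integral_XNn n (c : R) : (0 < n)%N -> 0 < c ->
  (\int[mu]_(x in `[c, +oo[) (x `^ (- n%:R - 1))%:E = (n%:R^-1 * c ^- n)%:E)%E.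
Proof.
move=> n0 c0; have n0' : n%:R != 0 :> R by rewrite pnatr_eq0 -lt0n.
rewrite (@ge0_FTC2y (fun x => x `^ (- n%:R - 1)) (fun x => - (n%:R^-1) * x `^ (- n%:R)))//.
- by rewrite mulNr opprK powR_invn// ltW.
- by move=> x _; exact: powR_ge0.
- move=> x cx; have x0 := lt_le_trans c0 cx.
  have [d _] := is_derive1_powR (- n%:R - 1) x0.
  by apply: differentiable_continuous; apply/derivable1_diffP.
- move=> x cx; have x0 := lt_le_trans c0 cx.
  have d := is_deriveM (is_derive_cst (- n%:R^-1 : R) x 1) (is_derive1_powR (- n%:R) x0).
  have {}d : is_derive x 1 (fun y => - (n%:R^-1) * y `^ (- n%:R)) (x `^ (- n%:R - 1)).
    by apply: is_derive_eq d _; rewrite /GRing.scale/= mulr0 addr0 mulrA mulrNN mulVf ?mul1r.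
  by case: d.
- rewrite -(mulr0 (- (n%:R^-1))); apply: cvgMr.
  have inv0 : (x^-1 : R) @[x --> +oo%R] --> (0 : R).
    by apply/gtr0_cvgV0; [exact: nbhs_pinfty_gt|exact: cvg_id].
  apply: squeeze_cvgr (cvg_cst 0) inv0; near=> x.
  have x1 : 1 <= x by near: x; exact: nbhs_pinfty_ge.
  rewrite powR_ge0/= -powR_inv1 ?(le_trans _ x1)//.
  by apply: ler_powR => //; rewrite lerN2 ler1n.
Unshelve. all: by end_near. Qed.
End Integrals1D.

Section Radial.
Context {R : realType}.
Local Notation mu := (@lebesgue_measure R).
Local Notation MR := (measurableTypeR R).

Lemma rv_measurable_cst n (c : R) : rv_measurableR (fun _ : 'rV[R]_n => c).
Proof. exact: (@measurable_cst _ _ _ _ setT c). Qed.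

Lemma rv_measurableM n (f g : 'rV[R]_n -> R) : rv_measurableR f -> rv_measurableR g ->
  rv_measurableR (fun x => f x * g x).
Proof. exact: measurable_funM. Qed.

Lemma rv_measurableX n (f : 'rV[R]_n -> R) k : rv_measurableR f ->
  rv_measurableR (fun x => f x ^+ k).
Proof. exact: measurable_funX. Qed.

Lemma leb_int_tonelli n (k : 'rV[R]_n -> R -> \bar R) :
  (forall x s, 0 <= k x s)%E ->
  measurable_fun [set: n.-tuple MR * MR] (fun p => k (rv_of_tuple p.1) p.2) ->
  leb_int (fun x => \int[mu]_s k x s)%E = (\int[mu]_s leb_int (fun x => k x s))%E.
Proof.
move=> k0 mk; have kp0 p : (0 <= k (rv_of_tuple p.1) p.2)%E by exact: k0.
rewrite leb_intE; last 2 first.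
- by move=> x; apply: integral_ge0 => s _; exact: k0.
- exact: (measurable_fun_fubini_tonelli_F (m2 := mu) _ mk kp0).
have := fubini_tonelli (m1 := lebesgue_n n) (m2 := mu) _ mk kp0 => /= ->.
apply: eq_integral => s _; rewrite leb_intE//.
exact: (measurableT_comp mk (pair2_measurable s)).
Qed.

Lemma measurable_leb_int n (k : 'rV[R]_n -> R -> \bar R) :
  (forall x s, 0 <= k x s)%E ->
  measurable_fun [set: n.-tuple MR * MR] (fun p => k (rv_of_tuple p.1) p.2) ->
  measurable_fun [set: R] (fun s => leb_int (fun x => k x s)).
Proof.
move=> k0 mk; have kp0 p : (0 <= k (rv_of_tuple p.1) p.2)%E by exact: k0.
have := measurable_fun_fubini_tonelli_G (m1 := lebesgue_n n) _ mk kp0.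
apply: eq_measurable_fun => s _; rewrite leb_intE//.
exact: (measurableT_comp mk (pair2_measurable s)).
Qed.

Lemma leb_intZ n (c : R) (g : 'rV[R]_n -> \bar R) : 0 <= c ->
  (forall x, 0 <= g x)%E -> rv_measurable g ->
  (leb_int (fun x => c%:E * g x) = c%:E * leb_int g)%E.
Proof.
move=> c0 g0 mg; rewrite !leb_intE//.
- by rewrite ge0_integralZl_EFin.
- by move=> x; rewrite mule_ge0// lee_fin.
- exact: measurable_funeM.
Qed.

Lemma leb_intD n (g h : 'rV[R]_n -> \bar R) :
  (forall x, 0 <= g x)%E -> (forall x, 0 <= h x)%E ->
  rv_measurable g -> rv_measurable h ->
  (leb_int (fun x => g x + h x) = leb_int g + leb_int h)%E.
Proof.
move=> g0 h0 mg mh; rewrite !leb_intE//.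
- by rewrite ge0_integralD.
- by move=> x; rewrite adde_ge0.
- exact: emeasurable_funD.
Qed.

Lemma leb_int_ge0 n (g : 'rV[R]_n -> \bar R) : (forall x, 0 <= g x)%E -> (0 <= leb_int g)%E.
Proof. by move=> g0; exact: iint_seq_ge0. Qed.

Lemma measurable_layer_kernel n (g Q : 'rV[R]_n -> R) (theta : R -> R) :
  rv_measurableR g -> rv_measurableR Q -> measurable_fun [set: R] theta ->
  measurable_fun [set: n.-tuple MR * MR] (fun p : n.-tuple MR * MR =>
    (if Q (rv_of_tuple p.1) <= p.2 then g (rv_of_tuple p.1) * theta p.2 else 0)%:E).
Proof.
move=> mg mQ mt; apply/measurable_EFinP; apply: measurable_fun_ifT.
- apply: measurable_fun_ler; first exact: (measurableT_comp mQ).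
  exact: measurable_snd.
- apply: measurable_funM; first exact: (measurableT_comp mg).
  exact: (measurableT_comp mt).
- exact: measurable_cst.
Qed.

(** Tonelli on the region {Q x <= r}. It serves twice: theta = r^k e^(-r) yields the Gamma
    integrals, theta = r^(-n-1) the polar formula. *)
Lemma leb_int_layer n (g Q : 'rV[R]_n -> R) (theta : R -> R) :
  rv_measurableR g -> rv_measurableR Q -> measurable_fun [set: R] theta ->
  (forall x, 0 <= g x) -> (forall r, 0 <= theta r) ->
  (leb_int (fun x => (g x)%:E * \int[mu]_(r in `[Q x, +oo[) (theta r)%:E) =
   \int[mu]_r ((theta r)%:E * leb_int (fun x => (if Q x <= r then g x else 0)%:E)))%E.
Proof.
move=> mg mQ mt g0 t0.
pose k x r := (if Q x <= r then g x * theta r else 0)%:E : \bar R.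
have k0 x r : (0 <= k x r)%E by rewrite /k lee_fin; case: ifP => // _; rewrite mulr_ge0.
have mk := measurable_layer_kernel mg mQ mt.
transitivity (leb_int (fun x => \int[mu]_r k x r)%E).
  congr leb_int; apply/funext => x.
  rewrite [in LHS]integral_mkcond -ge0_integralZl_EFin//; last 2 first.
  - by move=> r _; rewrite patchE; case: ifP => // _; rewrite lee_fin.
  - apply/(measurable_restrictT _ _).1; first exact: measurable_itv.
    by apply/measurable_EFinP; exact: measurable_funTS.
  apply: eq_integral => r _; rewrite patchE mem_setE in_itv/= andbT /k.
  by case: ifP => _; rewrite ?mule0// EFinM.
rewrite leb_int_tonelli//; apply: eq_integral => r _.
rewrite -leb_intZ//.
- congr leb_int; apply/funext => x; rewrite /k; case: ifP => _; rewrite ?mule0//.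
  by rewrite EFinM muleC.
- by move=> x; rewrite lee_fin; case: ifP.
- apply: rv_measurable_EFin; apply: measurable_fun_ifT.
  + by apply: measurable_fun_ler => //; exact: measurable_cst.
  + exact: mg.
  + exact: measurable_cst.
Qed.

Lemma ereal_ge_pinfty (I : \bar R) : (forall A : R, 0 < A -> (A%:E <= I)%E) -> I = +oo%E.
Proof.
case: I => [r| |] // H; last by have := H 1 ltr01.
have := H (`|r| + 1) (ltr_wpDl (normr_ge0 r) ltr01); rewrite lee_fin => h.
by exfalso; have := ler_norm r; lra.
Qed.

Lemma leb_int0 n : leb_int (fun _ : 'rV[R]_n => 0%:E) = 0%E :> \bar R.
Proof.
rewrite leb_intE//; first by rewrite integral0.
by apply: rv_measurable_EFin; exact: rv_measurable_cst.
Qed.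

Lemma leb_int_origin n : (0 < n)%N ->
  leb_int (fun x : 'rV[R]_n => (if enorm x <= 0 then 1 else 0)%:E) = 0%E :> \bar R.
Proof.
case: n => // n _.
have mp : rv_measurable (fun x : 'rV[R]_n.+1 => (if enorm x <= 0 then 1 else 0)%:E : \bar R).
  apply: rv_measurable_EFin; apply: measurable_fun_ifT; try exact: measurable_cst.
  apply: measurable_fun_ler; last exact: measurable_cst.
  by have := measurable_enormB (0 : 'rV[R]_n.+1); under eq_fun do rewrite subr0.
rewrite /leb_int /=.
have mF := measurable_iint_seq_cons _ (rv_seq_measurable mp).
rewrite -(@integral_setD1 _ _ 0).
- apply: integral0_eq => t [_ /eqP t0]; rewrite -[RHS](leb_int0 n).
  apply: eq_iint_seq => s sn; rewrite ifF//; apply/negbTE; rewrite -ltNge enorm_gt0.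
  by apply/eqP => /rowP/(_ ord0); rewrite !mxE; exact/eqP.
- by apply: measurableD.
- by apply: measurable_funTS; apply: mF => s; rewrite lee_fin; case: ifP.
Qed.

Section Homogeneous.
Variables (n : nat) (q : 'rV[R]_n -> R).
Hypotheses (mq : rv_measurableR q) (q0 : forall x, 0 <= q x)
  (qZ : forall c x, 0 < c -> q (c *: x) = c * q x).

Definition sublevel_vol : \bar R := leb_int (fun x => (if q x <= 1 then 1 else 0)%:E).

Lemma measurable_sublevel (r : R) (g : 'rV[R]_n -> R) : rv_measurableR g ->
  rv_measurable (fun x => (if q x <= r then g x else 0)%:E).
Proof.
move=> mg; apply: rv_measurable_EFin; apply: measurable_fun_ifT => //.
by apply: measurable_fun_ler => //; exact: measurable_cst.
Qed.

Lemma sublevel_scale (r : R) : 0 < r ->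
  leb_int (fun x => (if q x <= r then 1 else 0)%:E) = ((r ^+ n)%:E * sublevel_vol)%E.
Proof.
move=> r0; rewrite /sublevel_vol.
have m1 : rv_measurable (fun x => (if q x <= 1 then 1 else 0)%:E : \bar R).
  by apply: measurable_sublevel; exact: measurable_cst.
have ri : 0 < r^-1 by rewrite invr_gt0.
have F0 x : (0 <= (if q x <= 1 then 1 else 0)%:E :> \bar R)%E by rewrite lee_fin; case: ifP.
have := leb_int_affine 0 ri F0 m1.
rewrite exprVn invrK => <-; congr leb_int; apply/funext => x.
by rewrite addr0 qZ// ler_pdivrMl// mulr1.
Qed.

(** The integrand is the tail integral of r^k e^(-r) from q x on, so exchanging integrals leaves the
    integral of r^k e^(-r) r^n |{q <= 1}| over r > 0. The case k = 0 evaluates int e^(-q), and k = 1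
    evaluates int (q + 1) e^(-q). *)
Lemma leb_int_gamma_poly k :
  leb_int (fun x => (gamma_poly k (q x) * expR (- q x))%:E) =
  ((n + k)`!%:R%:E * sublevel_vol)%E.
Proof.
have V0 : (0 <= sublevel_vol)%E by apply: leb_int_ge0 => x; rewrite lee_fin; case: ifP.
pose theta (r : R) := if 0 <= r then r ^+ k * expR (- r) else 0.
have mX (j : nat) : measurable_fun [set: R] (fun r : R => r ^+ j * expR (- r)).
  apply: measurable_funM; first exact: measurable_funX.
  by apply: measurableT_comp => //; exact: measurable_oppr.
have mt : measurable_fun [set: R] theta.
  by apply: measurable_fun_ifT => //; exact: measurable_fun_ler.
have t0 r : 0 <= theta r.
  by rewrite /theta; case: ifP => // r0; rewrite mulr_ge0 ?expR_ge0// exprn_ge0.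
have m1 := @rv_measurable_cst n 1.
have := leb_int_layer m1 mq mt (fun=> ler01) t0.
have -> : (fun x => 1%:E * \int[mu]_(r in `[q x, +oo[) (theta r)%:E)%E =
    (fun x => (gamma_poly k (q x) * expR (- q x))%:E).
  apply/funext => x; rewrite mul1e -integral_Xn_expRN//.
  apply: eq_integral => r; rewrite inE/= in_itv/= andbT /theta => qr.
  by rewrite (le_trans (q0 x) qr).
have gE : (n + k)`!%:R = gamma_poly (n + k) 0 * expR (- 0) :> R.
  by rewrite oppr0 expR0 mulr1 gamma_poly0.
move=> ->; rewrite gE.
rewrite -integral_Xn_expRN// -ge0_integralZr//; last 2 first.
- by apply/measurable_EFinP; apply: measurable_funTS; exact: mX.
- by move=> r; rewrite /= in_itv/= andbT => r0; rewrite lee_fin mulr_ge0 ?expR_ge0// exprn_ge0.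
rewrite -integral_itv_obnd_cbnd; last first.
  apply: emeasurable_funM; last exact: measurable_cst.
  by apply/measurable_EFinP; apply: measurable_funTS; exact: mX.
rewrite [RHS]integral_mkcond.
have mL : measurable_fun [set: R] (fun r : R =>
    leb_int (fun x => (if q x <= r then 1 else 0)%:E)).
  have := measurable_leb_int (k := fun x r => (if q x <= r then 1 * 1 else 0)%:E) _
    (measurable_layer_kernel m1 mq (@measurable_cst _ _ R R setT 1)).
  rewrite mulr1; apply.
  by move=> x r; rewrite lee_fin; case: ifP.
(* The scaling of sublevel sets holds for r > 0 only, so the null point r = 0 is removed from both
   integrals. *)
have mD : measurable ([set: R] `\ 0) by exact: measurableD.
rewrite -(integral_setD1 mD); last first.
  apply: measurable_funTS; apply: emeasurable_funM => //.
  exact/measurable_EFinP.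
rewrite -[RHS](integral_setD1 mD); last first.
  apply: measurable_funTS; apply/(measurable_restrictT _ _).1.
    exact: measurable_itv.
  apply: emeasurable_funM; last exact: measurable_cst.
  by apply/measurable_EFinP; apply: measurable_funTS; exact: mX.
apply: eq_integral => r; rewrite inE/= => -[_ /eqP r0].
rewrite patchE mem_setE in_itv/= andbT /theta.
have [rpos|rneg|rz] := ltgtP 0 r; last by rewrite -rz eqxx in r0.
- by rewrite sublevel_scale// muleA -EFinM; congr (_%:E * _)%E; rewrite exprD; ring.
- by rewrite mul0e.
Qed.

(** This writes q^(-n) as a radial integral, and the divergence of that integral at 0 reproduces the
    convention 0^(-n) = +oo. *)
Lemma leb_int_XNn_itv (x : 'rV[R]_n) : (0 < n)%N ->
  (\int[mu]_(s in `[q x, +oo[) (if (0 < s)%R then s `^ (- n%:R - 1) else 0)%:E =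
   (n%:R^-1)%:E * (if (0 < q x)%R then (q x ^- n)%:E else +oo))%E.
Proof.
move=> n0; have n0' : 0 < n%:R^-1 :> R by rewrite invr_gt0 ltr0n.
case: ifPn => [qx|].
  rewrite -EFinM -integral_XNn//; apply: eq_integral => s; rewrite inE/= in_itv/= andbT => qs.
  by rewrite (lt_le_trans qx qs).
rewrite -leNgt => qx; rewrite gt0_muley ?lte_fin//.
apply: ereal_ge_pinfty => A A0.
(* With this cutoff the tail integral c^(-n) / n = (1 + n A)^n / n is at least A. *)
pose c := (1 + n%:R * A)^-1.
have c1 : 0 < 1 + n%:R * A by rewrite ltr_pwDl// mulr_ge0// ltW.
have c0 : 0 < c by rewrite invr_gt0.
apply: (@le_trans _ _ (\int[mu]_(s in `[c, +oo[) (s `^ (- n%:R - 1))%:E)%E).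
  rewrite integral_XNn// lee_fin ler_pdivlMl ?ltr0n// -exprVn invrK.
  apply: (@le_trans _ _ (1 + n%:R * A)); first by rewrite lerDr.
  by rewrite -[leLHS]expr1 ler_weXn2l// lerDl mulr_ge0// ltW.
have -> : (\int[mu]_(s in `[c, +oo[) (s `^ (- n%:R - 1))%:E)%E =
    (\int[mu]_(s in `[c, +oo[) (if (0 < s)%R then s `^ (- n%:R - 1) else 0)%:E)%E.
  apply: eq_integral => s; rewrite inE/= in_itv/= andbT => cs.
  by rewrite (lt_le_trans c0 cs).
apply: ge0_subset_integral => //.
- apply: measurable_funTS; apply/measurable_EFinP; apply: measurable_fun_ifT => //.
  by apply: measurable_fun_ltr => //; exact: measurable_cst.
- by move=> s _; rewrite lee_fin; case: ifP => // _; exact: powR_ge0.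
- move=> s /=; rewrite !in_itv/= !andbT => cs.
  by rewrite (le_trans qx)// (le_trans (ltW c0)).
Qed.

(* Both sides are computed from the double integral of
   [n * |x|^n * s^(n-1)] over [{q x <= 1, s |x| <= 1}], through [x = y / s]. *)
Lemma leb_int_polar : (0 < n)%N ->
  leb_int (fun x => if (enorm x <= 1) && (x != 0) then
      (if (0 < q ((enorm x)^-1 *: x))%R then (q ((enorm x)^-1 *: x) ^- n)%:E else +oo%E)
    else 0%E) = sublevel_vol.
Proof.
move=> n0; have nn : n%:R != 0 :> R by rewrite pnatr_eq0 -lt0n.
have q00 : q 0 = 0.
  have := @qZ 2 0 _; rewrite scaler0 => /(_ _)/wrap[]//; lra.
have mp : rv_measurableR (@enorm R n).
  by have := measurable_enormB (0 : 'rV[R]_n); under eq_fun do rewrite subr0.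
pose g (x : 'rV[R]_n) := if enorm x <= 1 then n%:R * enorm x ^+ n else 0 : R.
have g0 x : 0 <= g x.
  by rewrite /g; case: ifP => // _; rewrite mulr_ge0// exprn_ge0// enorm_ge0.
have mg : rv_measurableR g.
  apply: measurable_fun_ifT.
  - by apply: measurable_fun_ler => //; exact: measurable_cst.
  - by apply: measurable_funM => //; exact: measurable_funX.
  - exact: measurable_cst.
pose theta (s : R) := if 0 < s then s `^ (- n%:R - 1) else 0.
have t0 s : 0 <= theta s by rewrite /theta; case: ifP => // _; exact: powR_ge0.
have mt : measurable_fun [set: R] theta.
  apply: measurable_fun_ifT => //.
  by apply: measurable_fun_ltr => //; exact: measurable_cst.
(* By homogeneity q(x / |x|)^(-n) = |x|^n q(x)^(-n), and the factor n in g cancels the 1 / n of the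
   radial integral. At the origin g vanishes because n > 0, and 0 times +oo is 0. *)
transitivity (leb_int (fun x => (g x)%:E * \int[mu]_(r in `[q x, +oo[) (theta r)%:E)%E).
  congr leb_int; apply/funext => x; rewrite leb_int_XNn_itv// /g.
  have [x1|x1] /= := leP (enorm x) 1; last by rewrite mul0e.
  have [->|xn0] /= := eqVneq x 0.
    by rewrite enorm0 expr0n gtn_eqF// mulr0 mul0e.
  rewrite -enorm_gt0 in xn0; have xi : 0 < (enorm x)^-1 by rewrite invr_gt0.
  rewrite qZ// pmulr_rgt0//; case: ifP => qx.
    rewrite -!EFinM; congr EFin; rewrite exprMn exprVn invfM invrK.
    by field; rewrite nn expf_neq0// gt_eqF.
  by rewrite muleA -EFinM mulrAC mulfV// mul1r gt0_muley// lte_fin exprn_gt0.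
rewrite leb_int_layer//.
pose K (x : 'rV[R]_n) (s : R) : \bar R :=
  (if q x <= 1 then
     (if (0 < s) && (s * enorm x <= 1) then n%:R * enorm x ^+ n * s ^+ n.-1 else 0)
   else 0)%:E.
have K0 x s : (0 <= K x s)%E.
  rewrite /K lee_fin; case: ifP => // _; case: ifP => // /andP[s0 _].
  by rewrite mulr_ge0 ?exprn_ge0 ?(ltW s0)// mulr_ge0// exprn_ge0// enorm_ge0.
have mK : measurable_fun [set: n.-tuple MR * MR] (fun p => K (rv_of_tuple p.1) p.2).
  have mq1 : measurable_fun [set: n.-tuple MR * MR] (fun p => q (rv_of_tuple p.1)).
    exact: (measurableT_comp mq).
  have mp1 : measurable_fun [set: n.-tuple MR * MR] (fun p => enorm (rv_of_tuple p.1)).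
    exact: (measurableT_comp mp).
  have ms : measurable_fun [set: n.-tuple MR * MR] (fun p => p.2 : R).
    exact: measurable_snd.
  apply/measurable_EFinP; apply: measurable_fun_ifT; last exact: measurable_cst.
    by apply: measurable_fun_ler => //; exact: measurable_cst.
  apply: measurable_fun_ifT; last exact: measurable_cst.
    apply: measurable_and.
      by apply: measurable_fun_ltr => //; exact: measurable_cst.
    by apply: measurable_fun_ler; [exact: measurable_funM|exact: measurable_cst].
  apply: measurable_funM; last exact: measurable_funX.
  by apply: measurable_funM; [exact: measurable_cst|exact: measurable_funX].
transitivity (\int[mu]_s leb_int (fun x => K x s))%E.
  apply: eq_integral => s _; rewrite /theta.
  have [s0|s0] := ltP 0 s; last first.
    rewrite mul0e -(leb_int0 n); congr leb_int; apply/funext => x.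
    by rewrite /K ltNge s0/=; case: ifP.
  have G0 x : (0 <= (if q x <= s then g x else 0)%:E :> \bar R)%E by rewrite lee_fin; case: ifP.
  have mG := measurable_sublevel s mg.
  have gs x : g (s *: x) = if s * enorm x <= 1 then n%:R * (s * enorm x) ^+ n else 0.
    by rewrite /g enormZ gtr0_norm.
  have mgs : rv_measurableR (fun x => g (s *: x)).
    under eq_fun do rewrite gs.
    have msp : rv_measurableR (fun x : 'rV[R]_n => s * enorm x) by
      apply: rv_measurableM => //; exact: rv_measurable_cst.
    apply: measurable_fun_ifT; last exact: measurable_cst.
      by apply: measurable_fun_ler => //; exact: measurable_cst.
    exact: (rv_measurableM (rv_measurable_cst n%:R) (rv_measurableX n msp)).
  have -> : leb_int (fun x => (if q x <= s then g x else 0)%:E) =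
      ((s ^+ n)%:E * leb_int (fun x => (if q x <= 1 then g (s *: x) else 0)%:E))%E.
    have := leb_int_affine 0 s0 G0 mG.
    move=> /(congr1 (fun z => (s ^+ n)%:E * z)%E).
    rewrite muleA -EFinM divff ?expf_neq0 ?gt_eqF// mul1e => <-.
    congr (_ * leb_int _)%E; apply/funext => x.
    by rewrite addr0 qZ// ger_pMr.
  rewrite muleA -EFinM -leb_intZ//; last 3 first.
  - by rewrite mulr_ge0 ?powR_ge0// exprn_ge0// ltW.
  - by move=> x; rewrite lee_fin; case: ifP.
  - exact: measurable_sublevel.
  congr leb_int; apply/funext => x; rewrite /K s0/= gs.
  case: ifP => qx; last by rewrite mule0.
  case: ifP => sx; last by rewrite mule0.
  rewrite -EFinM; congr EFin.
  have -> : s `^ (- n%:R - 1) = (s ^+ n.-1 * s * s)^-1.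
    by rewrite -opprD natr1 powR_invn ?ltW// -!exprSr prednK.
  have -> : s ^+ n = s ^+ n.-1 * s by rewrite -exprSr prednK.
  rewrite exprMn.
  have -> : s ^+ n = s ^+ n.-1 * s by rewrite -exprSr prednK.
  by field; rewrite gt_eqF//= expf_neq0// gt_eqF.
rewrite -leb_int_tonelli//.
(* The value d = 1 gives the indicator of the origin, d = 0 that of its complement. *)
have m1 (d : R) : rv_measurableR (fun x : 'rV[R]_n => if enorm x <= 0 then d else 1 - d).
  apply: measurable_fun_ifT; try exact: measurable_cst.
  by apply: measurable_fun_ler => //; exact: measurable_cst.
(* For x nonzero the s-integral is n |x|^n times the integral of s^(n-1) over [0, 1 / |x|], which is
   1; for x = 0 it is 0, and the missing null point is put back afterwards. *)
transitivity (leb_int (fun x => (if q x <= 1 then if enorm x <= 0 then 0 else 1 - 0 else 0)%:E)).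
  congr leb_int; apply/funext => x; rewrite /K.
  case: ifPn => [qx|_]; last by rewrite integral0.
  have [p0|p0] := leP (enorm x) 0.
    have -> : enorm x = 0 by apply/eqP; rewrite eq_le p0 enorm_ge0.
    rewrite expr0n gtn_eqF// integral0_eq// => s _.
    by case: ifP; rewrite // [n%:R * _]mulr0 mul0r.
  rewrite subr0; set p := enorm x in p0 *.
  transitivity (\int[mu]_(s in `[0%R, p^-1%R]) ((n%:R * p ^+ n)%:E * (s ^+ n.-1)%:E))%E.
    rewrite -integral_itv_obnd_cbnd; last first.
      apply: measurable_funTS; apply: measurable_funeM; apply/measurable_EFinP.
      exact: measurable_funX.
    rewrite [RHS]integral_mkcond; apply: eq_integral => s _.
    rewrite patchE mem_setE in_itv/= -[p^-1]mul1r ler_pdivlMr//.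
    by case: ifP.
  rewrite ge0_integralZl_EFin//; last 3 first.
  - by move=> s; rewrite /= in_itv/= => /andP[s0 _]; rewrite lee_fin exprn_ge0.
  - by apply: measurable_funTS; apply/measurable_EFinP; exact: measurable_funX.
  - by rewrite mulr_ge0// exprn_ge0// ltW.
  rewrite integral_Xn ?invr_ge0 ?(ltW p0)// prednK// -EFinM; congr EFin.
  by rewrite exprVn; field; rewrite nn expf_neq0// gt_eqF.
rewrite -[LHS]adde0 -(leb_int_origin n0) -leb_intD.
- congr leb_int; apply/funext => x; rewrite -EFinD; congr EFin.
  have [p0|p0] := leP (enorm x) 0; last by rewrite subr0 addr0.
  have -> : x = 0 by apply/eqP; rewrite -enorm_eq0 eq_le p0 enorm_ge0.
  by rewrite q00 ler01 add0r.
- by move=> x; rewrite lee_fin; case: ifP => // _; case: ifP => // _; rewrite subr0.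
- by move=> x; rewrite lee_fin; case: ifP.
- by apply: measurable_sublevel; exact: m1.
- by apply: rv_measurable_EFin; have := m1 1; rewrite subrr.
Qed.

End Homogeneous.
End Radial.

(** * Entropy bound and its equality case *)

Section GaugeEntropy.
Context {R : realType}.
Local Notation mu := (@lebesgue_measure R).

(** As [fine] sends +oo to 0, positivity requires finiteness as well. With h = n / 2, the bound t^h
    >= 1 on [1, +oo[ keeps the integral above e^(-1), and t^h <= 1 + t^n keeps it finite. *)
Lemma Gamma_half_gt0 n : 0 < Gamma (n%:R / 2 + 1 : R).
Proof.
rewrite /Gamma addrK; set h := n%:R / 2; have h0 : 0 <= h by rewrite divr_ge0.
have mh : measurable_fun [set: R] (fun t : R => t `^ h * expR (- t)).
  apply: measurable_funM; first exact: measurable_powR.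
  by apply: measurableT_comp => //; exact: measurable_oppr.
have mhE : measurable_fun [set: R] (fun t : R => (t `^ h * expR (- t))%:E).
  exact/measurable_EFinP.
have ge0h (t : R) : (0 <= (t `^ h * expR (- t))%:E)%E.
  by rewrite lee_fin mulr_ge0 ?powR_ge0 ?expR_ge0.
have mX (j : nat) : measurable_fun [set: R] (fun r : R => (r ^+ j * expR (- r))%:E).
  apply/measurable_EFinP; apply: measurable_funM; first exact: measurable_funX.
  by apply: measurableT_comp => //; exact: measurable_oppr.
have X0 (j : nat) (r : R) : 0 <= r -> (0 <= (r ^+ j * expR (- r))%:E)%E.
  by move=> r0; rewrite lee_fin mulr_ge0 ?expR_ge0// exprn_ge0.
set I := (X in fine X).
have lower : ((expR (- 1))%:E <= I)%E.
  have := @integral_Xn_expRN R 0 1 ler01; rewrite /= mul1r => <-.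
  apply: (@le_trans _ _ (\int[mu]_(t in `[1%R, +oo[) (t `^ h * expR (- t))%:E)%E).
    apply: ge0_le_integral => //.
    - by move=> t; rewrite /= in_itv/= andbT => t1; apply: X0; apply: le_trans t1.
    - by apply: measurable_funTS; exact: mX.
    - by apply: measurable_funTS.
    - move=> t; rewrite /= in_itv/= andbT => t1; rewrite lee_fin ler_wpM2r ?expR_ge0//.
      by rewrite expr0 -(powRr0 t); apply: ler_powR.
  apply: ge0_subset_integral => //.
  - by apply: measurable_funTS.
  - by move=> t /=; rewrite !in_itv/= !andbT; apply: lt_le_trans.
have upper : (I < +oo)%E.
  apply: (@le_lt_trans _ _ (\int[mu]_(t in `[0%R, +oo[)
      ((t ^+ 0 * expR (- t))%:E + (t ^+ n * expR (- t))%:E))%E); last first.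
    rewrite ge0_integralD//.
    - by rewrite !integral_Xn_expRN// -EFinD ltry.
    - by move=> t; rewrite /= in_itv/= andbT => t0; exact: X0.
    - by apply: measurable_funTS; exact: mX.
    - by move=> t; rewrite /= in_itv/= andbT => t0; exact: X0.
    - by apply: measurable_funTS; exact: mX.
  rewrite /I integral_itv_obnd_cbnd; last exact: measurable_funTS.
  apply: ge0_le_integral => //.
  - exact: measurable_funTS.
  - by apply: measurable_funTS; apply: emeasurable_funD; exact: mX.
  move=> t; rewrite /= in_itv/= andbT => t0; rewrite -EFinD lee_fin -mulrDl.
  rewrite ler_wpM2r ?expR_ge0// expr0.
  have [t1|/ltW t1] := leP t 1.
    apply: (@le_trans _ _ 1); last by rewrite lerDl exprn_ge0.
    have h1 : (1 : R) `^ h = 1 by rewrite powR1.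
    by rewrite -h1; apply: ge0_ler_powR; rewrite // nnegrE.
  apply: (@le_trans _ _ (t ^+ n)); last by rewrite lerDr.
  rewrite -powR_mulrn//; apply: ler_powR => //.
  by rewrite /h ler_pdivrMr// ler_peMr// ler1n.
rewrite fine_gt0// upper andbT.
by apply: lt_le_trans lower; rewrite lte_fin expR_gt0.
Qed.

Lemma omega_gt0 n : 0 < omega R n.
Proof. by rewrite /omega divr_gt0 ?powR_gt0 ?pi_gt0// Gamma_half_gt0. Qed.

Lemma leb_int_le n (g h : 'rV[R]_n -> \bar R) : (forall x, 0 <= g x)%E ->
  rv_measurable g -> rv_measurable h -> (forall x, g x <= h x)%E ->
  (leb_int g <= leb_int h)%E.
Proof.
move=> g0 mg mh gh.
have h0 x : (0 <= h x)%E by exact: le_trans (g0 x) (gh x).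
by rewrite !leb_intE//; apply: ge0_le_integral => //.
Qed.

Lemma leb_int_gt0 n (g : 'rV[R]_n -> R) : (forall x, 0 < g x) -> rv_measurableR g ->
  (0 < leb_int (fun x => (g x)%:E))%E.
Proof.
move=> g0 mg; have g0' x : (0 <= (g x)%:E)%E by rewrite lee_fin ltW.
rewrite lt0e leb_int_ge0// andbT; apply/eqP => I0.
have [x _ /eqP] := leb_int_eq0_dense 0 g0' (rv_measurable_EFin mg) I0 ltr01.
by rewrite eqe gt_eqF.
Qed.

Lemma rv_measurable_expR n (g : 'rV[R]_n -> R) : rv_measurableR g ->
  rv_measurableR (fun x => expR (g x)).
Proof. by move=> mg; apply: measurableT_comp. Qed.

Lemma rv_measurableZ n (k : R) (g : 'rV[R]_n -> R) : rv_measurableR g ->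
  rv_measurableR (fun x => k * g x).
Proof. by move=> mg; apply: rv_measurableM => //; exact: rv_measurable_cst. Qed.

Lemma rv_measurable_max n (g h : 'rV[R]_n -> R) : rv_measurableR g ->
  rv_measurableR h -> rv_measurableR (fun x => Num.max (g x) (h x)).
Proof. by move=> mg mh; exact: (measurable_maxr mg mh). Qed.

Lemma rv_measurable_entropy n (g : 'rV[R]_n -> R) : rv_measurableR g ->
  rv_measurableR (fun x => expR (g x) * Num.max (g x) 0) /\
  rv_measurableR (fun x => expR (g x) * Num.max (- g x) 0).
Proof.
move=> mg; have m0 := @rv_measurable_cst R n 0.
have mN : rv_measurableR (fun x => - g x).
  have -> : (fun x => - g x) = (fun x => -1 * g x) by apply/funext => x; rewrite mulN1r.
  exact: rv_measurableZ.
by split; apply: rv_measurableM (rv_measurable_expR mg) _; exact: rv_measurable_max.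
Qed.

Lemma ln_posM (x y : R) : 0 < x -> 0 < y -> ln (x * y) = ln x + ln y.
Proof. by move=> x0 y0; rewrite lnM. Qed.

Lemma ln_posV (x : R) : 0 < x -> ln x^-1 = - ln x.
Proof. by move=> x0; rewrite lnV. Qed.

Lemma ln_posVX (x : R) n : 0 < x -> ln (x ^- n) = - (n%:R * ln x).
Proof. by move=> x0; rewrite ln_posV ?exprn_gt0// lnXn// mulr_natl. Qed.

Lemma ln_ge1BV (x : R) : 0 < x -> 1 - x^-1 <= ln x.
Proof. by move=> x0; have := expR_ge1Dx (- ln x); rewrite expRN lnK ?posrE//; lra. Qed.

(** The two sides agree at s = 1, so this compares their derivatives there. It is done
    quantitatively: take logarithms at s = 1 + t, bound both by ln u >= 1 - 1 / u, and divide by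
    t. *)
Lemma le_entropy_limit (N l m : R) : 0 <= N ->
  (forall s, 1 < s -> 1 + (s - 1) * m <= expR (- N * ln s - (s - 1) * l)) ->
  m <= - N - l.
Proof.
move=> N0 H; apply/ler_addgt0Pr => e e0.
(* The errors are at most t (2 m^2 + N), hence below e when t <= e / A. The bound t <= 1 / B gives
   |t m| <= 1/2, so that 1 + t m stays away from 0. *)
pose A := 2 * m ^+ 2 + N + 1; have A0 : 0 < A by rewrite /A; have := sqr_ge0 m; lra.
pose B := 2 * (`|m| + 1); have B0 : 0 < B by rewrite /B; have := normr_ge0 m; lra.
pose t := Num.min B^-1 (e / A).
have t0 : 0 < t by rewrite lt_min invr_gt0 B0 divr_gt0.
have tA : t * A <= e by rewrite -ler_pdivlMr// ge_min lexx orbT.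
have tm : t * `|m| <= 2^-1.
  have : t * B <= 1 by rewrite -ler_pdivlMr// mul1r ge_min lexx.
  by rewrite /B; lra.
have : `|t * m| <= 2^-1 by rewrite normrM gtr0_norm.
rewrite ler_norml => /andP[tm1 tm2].
have u0 : 0 < 1 + t * m by lra.
have := H (1 + t); rewrite ltrDl t0 => /(_ isT).
have -> : 1 + t - 1 = t by ring.
rewrite -{1}[1 + t * m]lnK ?posrE// ler_expR => h.
have t1 : 0 < 1 + t by lra.
have h1 := ln_ge1BV u0.
have h2 := ler_wpM2l N0 (ln_ge1BV t1).
have e1 : 1 - (1 + t * m)^-1 = t * (m / (1 + t * m)) by field; rewrite gt_eqF.
have e2 : 1 - (1 + t)^-1 = t * (1 + t)^-1 by field; rewrite gt_eqF.
have h3 : t * (m / (1 + t * m)) <= t * (- N / (1 + t) - l).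
  by rewrite e1 e2 in h1 h2; lra.
rewrite ler_pM2l// in h3.
have h4 : m - t * (2 * m ^+ 2) <= m / (1 + t * m).
  rewrite ler_pdivlMr//.
  have : 0 <= t * m ^+ 2 * (1 + 2 * (t * m)) by apply: mulr_ge0; [rewrite mulr_ge0 ?sqr_ge0 ?(ltW t0)|lra].
  have -> : (m - t * (2 * m ^+ 2)) * (1 + t * m) = m - t * m ^+ 2 * (1 + 2 * (t * m)) by ring.
  lra.
have h5 : - N / (1 + t) <= - N + t * N.
  rewrite ler_pdivrMr//.
  have : 0 <= N * t ^+ 2 by rewrite mulr_ge0 ?sqr_ge0.
  have -> : (- N + t * N) * (1 + t) = - N + N * t ^+ 2 by ring.
  lra.
have : t * A = t * (2 * m ^+ 2) + t * N + t by rewrite /A; ring.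
lra.
Qed.

(** * The right-hand side in terms of Z *)

Section Rhs.
Variables (n : nat) (beta : R) (f : 'rV[R]_n -> R).
Hypotheses (n0 : (0 < n)%N) (b0 : 0 < beta) (fL : lipschitz_Rn f).

Let q := dir_lip f.

Lemma dir_lip_props : [/\ rv_measurableR q, (forall x, 0 <= q x)
  & forall c x, 0 < c -> q (c *: x) = c * q x].
Proof.
have [L L0 fL'] := lipschitz_Rn_ge0 fL; split.
- exact: lipschitz_measurable (lipschitz_dir_lip L0 fL').
- by move=> x; exact: dir_lip_ge0 L0 fL' x.
- by move=> c x c0; rewrite /q (dir_lipZ L0 fL') gtr0_norm.
Qed.

Definition gauge_int : \bar R := leb_int (fun x => (expR (- (beta * q x)))%:E).

Lemma gauge_intE : gauge_int = ((n`!%:R * beta ^- n)%:E * sublevel_vol q)%E.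
Proof.
have [mq q0 qZ] := dir_lip_props.
have mbq : rv_measurableR (fun x => beta * q x) by exact: rv_measurableZ.
have bq0 x : 0 <= beta * q x by rewrite mulr_ge0// ltW.
have bqZ c x : 0 < c -> beta * q (c *: x) = c * (beta * q x).
  by move=> c0; rewrite qZ// mulrCA.
have := leb_int_gamma_poly mbq bq0 bqZ 0.
rewrite addn0 EFinM -muleA => H.
rewrite /gauge_int; under eq_fun do rewrite -[expR _]mul1r; rewrite H; congr (_ * _)%E.
have bi : 0 < beta^-1 by rewrite invr_gt0.
rewrite -exprVn -(sublevel_scale mq qZ bi); congr leb_int; apply/funext => x.
by rewrite -[beta^-1]mulr1 ler_pdivlMl.
Qed.

Lemma gauge_int_gt0 : (0 < gauge_int)%E.
Proof.
have [mq _ _] := dir_lip_props.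
apply: leb_int_gt0 => [x|]; first exact: expR_gt0.
apply: rv_measurable_expR; under eq_fun do rewrite -mulNr.
exact: rv_measurableZ.
Qed.

Lemma sphere_int_dir_deriv :
  sphere_int (fun xi => match dir_deriv_Linf f xi with
    | r%:E => if 0 < r then (r ^- n)%:E else +oo%E
    | +oo%E => 0%E
    | -oo%E => +oo%E
    end) = (n%:R%:E * sublevel_vol q)%E.
Proof.
have [mq q0 qZ] := dir_lip_props.
rewrite -(leb_int_polar mq qZ n0) /sphere_int; congr (_ * leb_int _)%E.
by apply/funext => x; case: ifP => // _; rewrite dir_deriv_LinfE.
Qed.

Lemma rhs_gauge (z : R) : gauge_int = z%:E -> rhs beta f = (- n%:R - ln z)%:E.
Proof.
move=> Zz; have := gauge_int_gt0; rewrite Zz lte_fin => z0.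
have n0' : 0 < n%:R :> R by rewrite ltr0n.
have f0 : 0 < n`!%:R :> R by rewrite ltr0n fact_gt0.
have k0 : 0 < n`!%:R * beta ^- n by rewrite mulr_gt0// invr_gt0 exprn_gt0.
move: Zz; rewrite gauge_intE; case V : (sublevel_vol q) => [v| |]; last 2 first.
- by rewrite gt0_muley.
- by rewrite gt0_muleNy.
move=> [zE]; have v0 : 0 < v by rewrite -(pmulr_rgt0 _ k0) zE.
rewrite /rhs /E_inf sphere_int_dir_deriv V -EFinM mulr_gt0//.
have o0 := omega_gt0 n.
have E0 : 0 < (n%:R * omega R n / (n%:R * v)) `^ n%:R^-1 :> R.
  by rewrite powR_gt0// divr_gt0// mulr_gt0.
have kc0 : 0 < k_const R n by rewrite powR_gt0// invr_gt0 mulr_gt0.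
rewrite E0; congr EFin.
(* The volume omega_n cancels between k_n and E_infty, and the factor n of the polar formula cancels
   the one in n omega_n; what remains is ln (n! beta^(-n) v) = ln z. *)
have lnk : ln (k_const R n) = n%:R^-1 * - (ln n`!%:R + ln (omega R n)).
  by rewrite /k_const ln_powR (ln_posV (mulr_gt0 f0 o0)) (ln_posM f0 o0).
have lnE : ln ((n%:R * omega R n / (n%:R * v)) `^ n%:R^-1) =
    n%:R^-1 * (ln (omega R n) - ln v).
  by rewrite ln_powR -mulf_div divff ?gt_eqF// mul1r ln_div ?posrE.
have lnz : ln z = ln n`!%:R - n%:R * ln beta + ln v.
  by rewrite -zE (ln_posM k0 v0) ln_posM ?invr_gt0 ?exprn_gt0// ln_posVX.
rewrite lnM ?posrE ?divr_gt0 ?mulr_gt0 ?expR_gt0// ln_div ?posrE ?mulr_gt0 ?expR_gt0//.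
rewrite expRK lnE lnz.
have -> : ln (beta * k_const R n) = ln beta + ln (k_const R n) by rewrite ln_posM.
by rewrite lnk; field; rewrite gt_eqF.
Qed.

End Rhs.

(** * The entropy inequality *)

Section Inequality.
Variables (n : nat) (beta : R) (f : 'rV[R]_n -> R).
Hypotheses (n0 : (0 < n)%N) (b0 : 0 < beta) (fL : lipschitz_Rn f)
  (f1 : leb_int (fun x => (expR (beta * f x))%:E) = 1%E).

Let q := dir_lip f.

Let measurable_exp (s : R) : rv_measurableR (fun x => expR (s * f x)).
Proof.
by apply: rv_measurable_expR; apply: rv_measurableZ; exact: lipschitz_measurable.
Qed.

(* Prekopa-Leindler with [u = exp (s beta f)], [w = exp (- s beta q)] and
   [h z = exp (beta f (s z))], at the weight [1 / s]. *)
Lemma exp_powers_pl_rel (s : R) : 1 < s ->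
  pl_rel s^-1 (leb_int (fun x => (expR (s * beta * f x))%:E))
    ((s ^- n)%:E * gauge_int beta f)%E (s ^- n)%:E.
Proof.
move=> s1; have s0 : 0 < s by exact: lt_trans s1.
have [L L0 fL'] := lipschitz_Rn_ge0 fL.
have [mq q0 qZ] := dir_lip_props fL.
have si : 0 < s^-1 < 1 by rewrite invr_gt0 s0 invf_lt1.
have HE : leb_int (fun z => (expR (beta * f (s *: z)))%:E) = (s ^- n)%:E.
  have := leb_int_affine 0 s0 (fun x => _) (rv_measurable_EFin (measurable_exp beta)).
  rewrite /= f1 mule1 => <- //; by congr leb_int; apply/funext => x; rewrite addr0.
have mG : rv_measurableR (fun x => expR (- (beta * q x))).
  by apply: rv_measurable_expR; under eq_fun do rewrite -mulNr; exact: rv_measurableZ.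
have WE : leb_int (fun y => (expR (- (s * (beta * q y))))%:E) = ((s ^- n)%:E * gauge_int beta f)%E.
  have := leb_int_affine 0 s0 (fun x => _) (rv_measurable_EFin mG).
  rewrite /= /gauge_int => <-; last by move=> x; rewrite lee_fin expR_ge0.
  congr leb_int; apply/funext => x; rewrite addr0 /q qZ//.
  by congr (expR (- _))%:E; ring.
rewrite -WE -HE; apply: prekopa_leindler => //.
- apply: rv_measurable_EFin; apply: rv_measurable_expR; apply: rv_measurableZ.
  apply: lipschitz_measurable; exists (L * s) => x y.
  by apply: le_trans (fL' _ _) _; rewrite -scalerBr enormZ gtr0_norm// mulrA.
move=> x y a b a0 b0' au bw; rewrite lte_fin in au; rewrite lte_fin in bw.
rewrite lee_fin.
have t0 : 0 < 1 - s^-1 by rewrite subr_gt0; case/andP: si.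
apply: (@le_trans _ _ (expR (s * beta * f x) `^ s^-1 * expR (- (s * (beta * q y))) `^ (1 - s^-1))).
  apply: ler_pM; rewrite ?powR_ge0//; apply: ge0_ler_powR; rewrite ?nnegrE ?expR_ge0 ?(ltW _)//.
    by case/andP: si.
rewrite -!expRM -expRD ler_expR scalerDr !scalerA divff ?gt_eqF// scale1r.
have := dir_lipP L0 fL' y x (s * (1 - s^-1)).
have -> : s * (1 - s^-1) = s - 1 by field; rewrite gt_eqF.
rewrite -/q [`|s - 1|]ger0_norm ?subr_ge0 ?(ltW s1)// ler_norml => /andP[h _].
have -> : s * beta * f x * s^-1 + - (s * (beta * q y)) * (1 - s^-1) =
    beta * (f x - q y * (s - 1)) by field; rewrite gt_eqF.
by rewrite ler_pM2l//; lra.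
Qed.

(** If Z were infinite, Prekopa-Leindler at s = 2 would bound (a b)^(1/2) by 2^(-n) <= 1 for some
    fixed a > 0 and every b > 0. *)
Lemma gauge_int_fin : gauge_int beta f \is a fin_num.
Proof.
have Z0 := gauge_int_gt0 beta fL.
rewrite ge0_fin_numE ?ltW// ltNge leye_eq; apply/negP => /eqP Zoo.
have := @exp_powers_pl_rel 2 (ltr1n _ 2).
rewrite Zoo gt0_muley ?lte_fin ?invr_gt0 ?exprn_gt0//.
have : (0 < leb_int (fun x => (expR (2 * beta * f x))%:E))%E.
  by apply: leb_int_gt0 => [x|]; [exact: expR_gt0|exact: measurable_exp].
set U := leb_int _ => U0.
have [a a0 aU] : exists2 a : R, 0 < a & (a%:E < U)%E.
  move: U0; case: U => [u| |]// u0; last by exists 1; rewrite ?ltry.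
  by rewrite lte_fin in u0; exists (u / 2); rewrite ?lte_fin; lra.
move=> H; pose c : R := a `^ 2^-1; have c0 : 0 < c by rewrite powR_gt0.
have h2 : (1 - 2^-1 : R) = 2^-1 by lra.
(* With c the square root of a, the choice b = B^2 makes the left-hand side c B = 1 + c > 1. *)
pose B : R := c^-1 + 1; have B0 : 0 < B by rewrite ltr_wpDl ?invr_ge0// ltW.
have := H a (B ^+ 2) a0 (exprn_gt0 _ B0) aU (ltry _).
rewrite lee_fin h2 -(powR_mulrn 2 (ltW B0)) -powRrM divff// powRr1 ?(ltW B0)// -/c.
rewrite (_ : c * B = 1 + c); last by rewrite /B mulrDr mulr1 divff// gt_eqF.
have : (2 : R) ^- n <= 1 by rewrite invf_le1 ?exprn_gt0// exprn_ege1// ler1n.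
lra.
Qed.

(** The exponential is s^(-n) z^(1 - s): let b tend to s^(-n) z in the Prekopa-Leindler relation and
    solve for a. *)
Lemma exp_powers_le (s z : R) : 1 < s -> gauge_int beta f = z%:E ->
  (leb_int (fun x => (expR (s * beta * f x))%:E) <=
   (expR (- n%:R * ln s - (s - 1) * ln z))%:E)%E.
Proof.
move=> s1 Zz; have s0 : 0 < s by exact: lt_trans s1.
have z0 : 0 < z by have := gauge_int_gt0 beta fL; rewrite Zz lte_fin.
have := exp_powers_pl_rel s1; rewrite Zz -EFinM; set U := leb_int _ => H.
have sn0 : 0 < s ^- n by rewrite invr_gt0 exprn_gt0.
have lnsn : ln (s ^- n) = - n%:R * ln s.
  by rewrite ln_posVX// mulNr.
have key (a : R) : 0 < a -> (a%:E < U)%E -> ln a <= - n%:R * ln s - (s - 1) * ln z.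
  move=> a0 aU; apply/ler_addgt0Pr => e e0.
  pose w := s ^- n * z; have w0 : 0 < w by rewrite mulr_gt0.
  (* Taking b = w e^(-d) costs (1 - 1 / s) d in the logarithm, which becomes (s - 1) d = e after
     multiplication by s. *)
  pose d := e / (s - 1); have d0 : 0 < d by rewrite divr_gt0// subr_gt0.
  pose b := w * expR (- d); have bpos : 0 < b by rewrite mulr_gt0 ?expR_gt0.
  have bw : b < w by rewrite gtr_pMr// expR_lt1 oppr_lt0.
  have := H a b a0 bpos aU; rewrite lte_fin lee_fin => /(_ bw).
  rewrite -ler_ln ?posrE ?mulr_gt0 ?powR_gt0//.
  rewrite lnM ?posrE ?powR_gt0// !ln_powR lnsn /b lnM ?posrE ?expR_gt0// expRK.
  rewrite /w lnM ?posrE// lnsn => h.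
  have := ler_wpM2l (ltW s0) h.
  have -> : s * (s^-1 * ln a + (1 - s^-1) * (- n%:R * ln s + ln z - d)) =
      ln a + (s - 1) * (- n%:R * ln s + ln z) - (s - 1) * d.
    by field; rewrite gt_eqF.
  have -> : (s - 1) * d = e by rewrite /d mulrCA divff ?mulr1// subr_eq0 gt_eqF.
  lra.
set C := (X in expR X); have U0 : (0 <= U)%E by apply: leb_int_ge0 => x; rewrite lee_fin expR_ge0.
rewrite leNgt; apply/negP => UC.
have [a aC aU] : exists2 a : R, expR C < a & (a%:E < U)%E.
  move: UC; case: U {H key U0} => [u| |]// uC; last by exists (expR C + 1); rewrite ?ltry// ltrDl.
  by rewrite lte_fin in uC; exists ((expR C + u) / 2); rewrite ?lte_fin; lra.
have a0 : 0 < a by apply: lt_trans aC; exact: expR_gt0.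
have := key a a0 aU; rewrite -/C -ler_expR lnK ?posrE//; lra.
Qed.

(** With g = beta f, integrate e^(s g) >= e^g (1 + (s - 1) g) and compare with the bound on int e^(s
    g). The positive part of g stays on the left and the negative part on the right, so no infinite
    quantities are subtracted. *)
Lemma Ent_exp_le (z : R) : gauge_int beta f = z%:E ->
  (Ent_exp beta f <= (- n%:R - ln z)%:E)%E.
Proof.
move=> Zz; rewrite /Ent_exp.
have mf : rv_measurableR f by exact: lipschitz_measurable.
have mg : rv_measurableR (fun x => beta * f x) by exact: rv_measurableZ.
pose gp x := expR (beta * f x) * Num.max (beta * f x) 0.
pose gn x := expR (beta * f x) * Num.max (- (beta * f x)) 0.
have gp0 x : 0 <= gp x by rewrite mulr_ge0 ?expR_ge0// le_max lexx orbT.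
have gn0 x : 0 <= gn x by rewrite mulr_ge0 ?expR_ge0// le_max lexx orbT.
have [mgp mgn] : rv_measurableR gp /\ rv_measurableR gn by exact: rv_measurable_entropy.
change (leb_int (EFin \o gp) - leb_int (EFin \o gn) <= (- n%:R - ln z)%:E)%E.
have main (s : R) : 1 < s -> (1 + (s - 1)%:E * leb_int (EFin \o gp) <=
    (expR (- n%:R * ln s - (s - 1) * ln z))%:E + (s - 1)%:E * leb_int (EFin \o gn))%E.
  move=> s1; have s1' : 0 <= s - 1 by rewrite subr_ge0 ltW.
  apply: le_trans (leeD2r _ (exp_powers_le s1 Zz)).
  rewrite -f1 -!leb_intZ//; try exact: rv_measurable_EFin.
  rewrite -!leb_intD//; try (by move=> x; rewrite ?mule_ge0 ?lee_fin ?expR_ge0);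
    try (by apply: rv_measurable_EFin; exact: measurable_exp);
    try (by apply: measurable_funeM; exact: rv_measurable_EFin).
  apply: leb_int_le.
  - by move=> x; rewrite -EFinM -EFinD lee_fin addr_ge0 ?expR_ge0// mulr_ge0.
  - apply: emeasurable_funD; first exact: (rv_measurable_EFin (measurable_exp beta)).
    by apply: measurable_funeM; exact: rv_measurable_EFin.
  - apply: emeasurable_funD; first exact: (rv_measurable_EFin (measurable_exp _)).
    by apply: measurable_funeM; exact: rv_measurable_EFin.
  move=> x; rewrite /= -!EFinM -!EFinD lee_fin /gp /gn; set g := beta * f x.
  have -> : s * beta * f x = g + (s - 1) * g by rewrite /g; ring.
  have mm : Num.max g 0 - Num.max (- g) 0 = g.
    by case: (lerP 0 g) => g0; [rewrite (max_idPr _)|rewrite (max_idPl _)]; lra.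
  rewrite expRD; have h := expR_ge1Dx ((s - 1) * g).
  have := ler_wpM2l (expR_ge0 g) h; rewrite mulrDr mulr1.
  have := congr1 (fun w => expR g * ((s - 1) * w)) mm; rewrite /=; lra.
have P0 : (0 <= leb_int (EFin \o gp))%E by apply: leb_int_ge0 => x; rewrite lee_fin.
have Q0 : (0 <= leb_int (EFin \o gn))%E by apply: leb_int_ge0 => x; rewrite lee_fin.
(* An infinite negative part makes the difference -oo whatever the positive part is. With a finite
   negative part, [main] at s = 2 excludes an infinite positive part. *)
case: (leb_int (EFin \o gn)) main Q0 => [k| |]// main _; last by rewrite addeNy leNye.
case: (leb_int (EFin \o gp)) main P0 => [p| |]// main _; last first.
  have := main 2 (ltr1n _ 2).
  by rewrite gt0_muley ?addey// lte_fin; lra.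
rewrite -EFinB lee_fin; apply: le_entropy_limit => // s s1.
have := main s s1; rewrite -!EFinM -!EFinD lee_fin; lra.
Qed.

End Inequality.

Lemma enorm_ge_coord n (x : 'rV[R]_n) i : `|x 0 i| <= enorm x.
Proof.
rewrite -sqrtr_sqr ler_wsqrtr// (bigD1 i)//= lerDl sumr_ge0// => j _.
exact: sqr_ge0.
Qed.

Lemma enorm_mulmx_le n (B : 'M[R]_n) :
  exists K, forall x : 'rV_n, enorm (x *m B) <= K * enorm x.
Proof.
exists (\sum_j \sum_i `|B i j|) => x; apply: le_trans (enorm_le_sum _) _.
rewrite mulr_suml; apply: ler_sum => j _; rewrite mxE mulr_suml.
apply: le_trans (ler_norm_sum _ _ _) _; apply: ler_sum => i _.
by rewrite normrM mulrC ler_wpM2l// enorm_ge_coord.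
Qed.

(** * Cones attain equality *)

Section Equality.
Variables (n : nat) (beta b c : R) (B : 'M[R]_n) (x0 : 'rV[R]_n).
Hypotheses (n0 : (0 < n)%N) (beta0 : 0 < beta) (b0 : 0 < b).

Let p (x : 'rV[R]_n) := enorm (x *m B).
Let f (x : 'rV[R]_n) := c - b * p (x - x0).
Let Q (x : 'rV[R]_n) := beta * (b * p x).

Hypothesis f1 : leb_int (fun x => (expR (beta * f x))%:E) = 1%E.

Let p_increment x y : `|p x - p y| <= p (x - y).
Proof.
have H u v : p u - p v <= p (u - v).
  by rewrite lerBlDr -{1}(subrK v u) /p mulmxDl; exact: ler_enormD.
have pN : p (y - x) = p (x - y) by rewrite -opprB /p mulNmx enormN.
by rewrite ler_norml; have := H x y; have := H y x; rewrite pN => h1 h2; apply/andP; split; lra.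
Qed.

Let cone_increment x y : `|f x - f y| <= b * p (x - y).
Proof.
have -> : f x - f y = - (b * (p (x - x0) - p (y - x0))) by rewrite /f; ring.
rewrite normrN normrM gtr0_norm// ler_pM2l//; apply: le_trans (p_increment _ _) _.
by rewrite opprB addrA subrK.
Qed.

Lemma lipschitz_cone : lipschitz_Rn f.
Proof.
have [K BK] := enorm_mulmx_le B; exists (b * K) => x y.
by apply: le_trans (cone_increment x y) _; rewrite -mulrA ler_pM2l//; exact: BK.
Qed.

(** The supremum is attained at the vertex: from x0 to x0 + v the cone drops by exactly b |v B|. *)
Lemma dir_lip_cone v : dir_lip f v = b * p v.
Proof.
have [L L0 fL] := lipschitz_Rn_ge0 lipschitz_cone.
have pv0 : 0 <= b * p v by rewrite mulr_ge0 ?enorm_ge0// ltW.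
apply/eqP; rewrite eq_le; apply/andP; split.
  apply: (dir_lip_le L0 fL) => // x t; apply: le_trans (cone_increment _ _) _.
  by rewrite addrAC subrr add0r /p -scalemxAl enormZ -mulrA [_ * `|t|]mulrC.
have := dir_lipP L0 fL v x0 1; rewrite normr1 mulr1; apply: le_trans.
rewrite /f subrr scale1r.
have -> : x0 + v - x0 = v by rewrite addrC addKr.
rewrite [p 0]/p mul0mx enorm0.
have -> : c - b * p v - (c - b * 0) = - (b * p v) by ring.
by rewrite normrN ger0_norm.
Qed.

Let measurable_p y : rv_measurableR (fun x => p (x - y)).
Proof.
have [K BK] := enorm_mulmx_le B.
apply: lipschitz_measurable; exists K => x z.
apply: le_trans (p_increment _ _) _; rewrite opprB addrA subrK; exact: BK.
Qed.

Let measurable_Q : rv_measurableR Q.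
Proof.
do 2 apply: rv_measurableZ; have := measurable_p 0.
by under eq_fun do rewrite subr0.
Qed.

Let Q0 x : 0 <= Q x.
Proof. by rewrite !mulr_ge0 ?enorm_ge0 ?(ltW beta0) ?(ltW b0). Qed.

Let QZ k x : 0 < k -> Q (k *: x) = k * Q x.
Proof.
by move=> k0; rewrite /Q /p -scalemxAl enormZ gtr0_norm//; ring.
Qed.

Let measurable_expQ : rv_measurableR (fun x => expR (- Q x)).
Proof.
apply: rv_measurable_expR; under eq_fun do rewrite -mulN1r; exact: rv_measurableZ.
Qed.

Let leb_int_translate (g : 'rV[R]_n -> R) : (forall x, 0 <= g x) -> rv_measurableR g ->
  leb_int (fun x => (expR (beta * c) * g (x - x0))%:E) =
  ((expR (beta * c))%:E * leb_int (EFin \o g))%E.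
Proof.
move=> g0 mg.
have g0' x : (0 <= (EFin \o g) x)%E by rewrite /= lee_fin.
rewrite -leb_intZ ?expR_ge0//; last exact: rv_measurable_EFin.
have g1 x : (0 <= (expR (beta * c) * g x)%:E)%E by rewrite lee_fin mulr_ge0 ?expR_ge0.
have := leb_int_affine (- x0) ltr01 g1 (rv_measurable_EFin (rv_measurableZ _ mg)).
rewrite expr1n invr1 mul1e => H.
rewrite -[RHS]/(leb_int (fun x => (expR (beta * c) * g x)%:E)) -H.
by congr leb_int; apply/funext => x; rewrite scale1r.
Qed.

Let expR_f x : expR (beta * f x) = expR (beta * c) * expR (- Q (x - x0)).
Proof. by rewrite -expRD; congr expR; rewrite /f /Q; ring. Qed.

(** The value is read off from the normalization of f, without a change of variables by B;
    finiteness follows at the same time. *)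
Let leb_int_expQ : leb_int (fun x => (expR (- Q x))%:E) = (expR (- (beta * c)))%:E.
Proof.
have := f1; under eq_fun do rewrite expR_f.
rewrite (leb_int_translate (fun x => expR_ge0 (- Q x)) measurable_expQ) => H.
have e0 := expR_gt0 (beta * c).
move: H; rewrite (_ : EFin \o _ = (fun x => (expR (- Q x))%:E))//.
case: (leb_int _) => [r| |].
- by rewrite -EFinM => -[H]; rewrite expRN -[r](mulKf (lt0r_neq0 e0)) H mulr1.
- by rewrite gt0_muley// lte_fin.
- by rewrite gt0_muleNy// lte_fin.
Qed.

(** The Gamma integrals for k = 1 and k = 0 have ratio n + 1, so int (Q + 1) e^(-Q) = (n + 1) int
    e^(-Q). *)
Let leb_int_QexpQ :
  leb_int (fun x => (Q x * expR (- Q x))%:E) = (n%:R * expR (- (beta * c)))%:E.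
Proof.
have H0 := leb_int_gamma_poly measurable_Q Q0 QZ 0.
have H1 := leb_int_gamma_poly measurable_Q Q0 QZ 1.
rewrite addn0 in H0; rewrite addn1 factS natrM EFinM -muleA -H0 in H1.
move: H1; rewrite /=.
under [X in (_ * leb_int X)%E]eq_fun do rewrite mul1r.
under eq_fun do rewrite mulrDl !mul1r expr1 EFinD.
rewrite leb_intD.
- rewrite leb_int_expQ; case: (leb_int _) => [r| |]//.
  rewrite -EFinD -EFinM => -[H]; congr EFin.
  by rewrite -[r](addrK (expR (- (beta * c)))) H -natr1; ring.
- by move=> x; rewrite lee_fin mulr_ge0 ?expR_ge0.
- by move=> x; rewrite lee_fin expR_ge0.
- by apply: rv_measurable_EFin; exact: rv_measurableM.
- exact: rv_measurable_EFin.
Qed.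

Lemma rhs_cone : rhs beta f = (beta * c - n%:R)%:E.
Proof.
rewrite (@rhs_gauge _ beta f n0 beta0 lipschitz_cone (expR (- (beta * c)))).
  by rewrite expRK; congr EFin; ring.
rewrite /gauge_int -leb_int_expQ; congr leb_int; apply/funext => x.
by rewrite dir_lip_cone.
Qed.

(** Since beta f = beta c - Q(x - x0), the entropy is beta c minus e^(beta c) int Q e^(-Q) = n.
    [main] states this as an equality of sums of nonnegative integrals, with positive and negative
    parts separated. *)
Lemma Ent_cone : Ent_exp beta f = (beta * c - n%:R)%:E.
Proof.
have mf : rv_measurableR f by exact: lipschitz_measurable lipschitz_cone.
have mg : rv_measurableR (fun x => beta * f x) by exact: rv_measurableZ.
pose gp x := expR (beta * f x) * Num.max (beta * f x) 0.
pose gn x := expR (beta * f x) * Num.max (- (beta * f x)) 0.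
pose gq x := expR (beta * c) * (Q (x - x0) * expR (- Q (x - x0))).
have gp0 x : 0 <= gp x by rewrite mulr_ge0 ?expR_ge0// le_max lexx orbT.
have gn0 x : 0 <= gn x by rewrite mulr_ge0 ?expR_ge0// le_max lexx orbT.
have gq0 x : 0 <= gq x by rewrite mulr_ge0 ?expR_ge0// mulr_ge0 ?expR_ge0.
have [mgp mgn] : rv_measurableR gp /\ rv_measurableR gn by exact: rv_measurable_entropy.
have me : rv_measurableR (fun x => expR (beta * f x)) by exact: rv_measurable_expR.
have gqE x : gq x = expR (beta * f x) * (beta * c - beta * f x).
  by rewrite expR_f /gq -mulrA [expR (- _) * _]mulrC; congr (_ * (_ * _)); rewrite /f /Q; ring.
have mgq : rv_measurableR gq.
  have -> : gq = fun x => expR (beta * f x) * (beta * c - beta * f x) by apply/funext.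
  apply: rv_measurableM => //.
  have -> : (fun x => beta * c - beta * f x) = (fun x => (beta * b) * p (x - x0)).
    by apply/funext => x; rewrite /f; ring.
  exact: rv_measurableZ.
change (leb_int (EFin \o gp) - leb_int (EFin \o gn) = (beta * c - n%:R)%:E)%E.
have GQ : leb_int (EFin \o gq) = n%:R%:E.
  have := leb_int_translate (g := fun x => Q x * expR (- Q x)).
  rewrite (_ : (fun x => _) = EFin \o gq)// => ->.
  - rewrite [leb_int _]leb_int_QexpQ -EFinM; congr EFin.
    by rewrite mulrCA -expRD subrr expR0 mulr1.
  - by move=> x; rewrite mulr_ge0 ?expR_ge0.
  - exact: rv_measurableM.
pose cp := Num.max (beta * c) 0; pose cn := Num.max (- (beta * c)) 0.
have cp0 : 0 <= cp by rewrite le_max lexx orbT.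
have cn0 : 0 <= cn by rewrite le_max lexx orbT.
have mm (w : R) : Num.max w 0 - Num.max (- w) 0 = w.
  by case: (lerP 0 w) => w0; [rewrite (max_idPr _)|rewrite (max_idPl _)]; lra.
have E0 x : 0 <= expR (beta * f x) by exact: expR_ge0.
have cst_int k : 0 <= k -> leb_int (fun x => (k * expR (beta * f x))%:E) = k%:E.
  move=> k0; under eq_fun do rewrite EFinM.
  rewrite leb_intZ ?f1 ?mule1//; last exact: rv_measurable_EFin.
(* The cone is bounded above by c, so the positive part is finite; [main] then forces the negative
   part to be finite too. *)
have Pfin : (leb_int (EFin \o gp) <= cp%:E)%E.
  rewrite -(cst_int cp)//; apply: leb_int_le.
  - by move=> x; rewrite lee_fin.
  - exact: rv_measurable_EFin.
  - by apply: rv_measurable_EFin; exact: rv_measurableZ.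
  move=> x; rewrite lee_fin /gp mulrC ler_wpM2r//.
  have fc : beta * f x <= beta * c.
    by rewrite ler_pM2l// /f gerBl mulr_ge0 ?enorm_ge0// ltW.
  by rewrite ge_max /cp !le_max fc lexx orbT.
have main : (leb_int (EFin \o gp) + (n%:R%:E + cn%:E) = leb_int (EFin \o gn) + cp%:E)%E.
  rewrite -GQ -(cst_int cn)// -(cst_int cp)//.
  have mk k : rv_measurable (fun x => (k * expR (beta * f x))%:E).
    by apply: rv_measurable_EFin; exact: rv_measurableZ.
  have k0 k x : 0 <= k -> (0 <= (k * expR (beta * f x))%:E)%E.
    by move=> k0; rewrite lee_fin mulr_ge0.
  have [mP mN mQ] := And3 (rv_measurable_EFin mgp) (rv_measurable_EFin mgn) (rv_measurable_EFin mgq).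
  rewrite -leb_intD//; [|by move=> x; exact: k0].
  rewrite -leb_intD//; [|by move=> x; exact: k0].
  rewrite -leb_intD//; last 2 first.
  - by move=> x; rewrite adde_ge0 ?k0// lee_fin.
  - exact: (emeasurable_funD mQ (mk cn)).
  congr leb_int; apply/funext => x; rewrite /= -!EFinD; congr EFin.
  have := congr1 ( *%R (expR (beta * f x))) (mm (beta * f x)).
  have := congr1 ( *%R (expR (beta * f x))) (mm (beta * c)).
  rewrite gqE /gp /gn /cp /cn; lra.
have P0 : (0 <= leb_int (EFin \o gp))%E by apply: leb_int_ge0 => x; rewrite lee_fin.
have N0 : (0 <= leb_int (EFin \o gn))%E by apply: leb_int_ge0 => x; rewrite lee_fin.
case: (leb_int (EFin \o gp)) Pfin P0 main => [P| |]// _ _.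
case: (leb_int (EFin \o gn)) N0 => [N| |]// _.
rewrite -!EFinD => -[H]; congr EFin; have := mm (beta * c); rewrite -/cp -/cn; lra.
Qed.

End Equality.
End GaugeEntropy.

Theorem theorem1p2 (R : realType) (n : nat) (beta : R) :
  (1 <= n)%N -> 0 < beta ->
  (forall f : 'rV[R]_n -> R,
     lipschitz_Rn f ->
     leb_int (fun x => (expR (beta * f x))%:E) = 1%E ->
     (Ent_exp beta f <= rhs beta f)%E)
  /\
  (forall (a : 'rV[R]_n) (b c : R) (A : 'M[R]_n),
     0 < b -> \det A = 1 ->
     let f := fun x : 'rV[R]_n => c - b * enorm ((A *m x^T)^T - a) in
     leb_int (fun x => (expR (beta * f x))%:E) = 1%E ->
     Ent_exp beta f = rhs beta f).
Proof.
move=> n0 beta0; split=> [f fL f1|a b c A b0 detA f f1].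
  have /fineK/esym Zz := gauge_int_fin beta0 fL f1.
  by rewrite (rhs_gauge n0 beta0 fL Zz); exact: Ent_exp_le.
have uA : A^T \in unitmx by rewrite unitmxE det_tr detA unitr1.
(* In row form A x - a becomes (x - x0) A^T, where x0 solves x0 A^T = a. *)
pose x0 := a *m invmx A^T.
have fE : f = fun x => c - b * enorm ((x - x0) *m A^T).
  apply/funext => x; rewrite /f trmx_mul trmxK mulmxBl /x0 mulmxKV//.
rewrite fE in f1 *.
by rewrite (Ent_cone beta0 b0 f1) (rhs_cone n0 beta0 b0 f1).
Qed.
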